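(* The restriction $c|_{\mathcal{P}}:\mathcal{P}\to\mathcal{C}^{odd}$ of Solomon's epimorphism is an epimorphism of algebras for both the inner and the outer products, and $$\ker c|_{\mathcal{P}_n}=\Big\langle\big\{\tilde\Xi^q-\tilde\Xi^{\dot q}\ \big|\ q,\dot q\text{ odd compositions of }n,\ q\approx\dot q\big\}\Big\rangle_K$$ for all $n\in\mathbb{N}_0$. Furthermore, $c(\tilde\Xi^n)=\sum_p2^{\ell(p)}\,\mathsf{char}_p$, where the sum is over all odd partitions $p$ of $n$ (partitions of $n$ all of whose parts are odd).
   Context: $K$ is a field of characteristic $0$. Permutations act on the right ($i\pi$ is the image of $i$) and products in $S_n$ are read from left to right. For $\pi\in S_n$: $\mathrm{Des}(\pi)=\{1\le i\le n-1\mid i\pi>(i+1)\pi\}$, $\mathrm{Peak}(\pi)=\{2\le i\le n-1\mid (i-1)\pi<i\pi>(i+1)\pi\}$. For $D\subseteq\{1,\ldots,n-1\}$ let $\Delta^D=\sum_{\mathrm{Des}(\pi)=D}\pi$ and $\Xi^D=\sum_{E\subseteq D}\Delta^E$; $\mathcal{D}_n$ is the span of the $\Delta^D$ and $\mathcal{D}=\bigoplus_{n\ge0}\mathcal{D}_n$. $\mathbb{N}^*$ is the free monoid over the positive integers, with concatenation $q.r$; $q=q_1.\cdots.q_k\in\mathbb{N}^*$ has length $\ell(q)=k$, is a composition of $n$ if its sum is $n$, and is odd if all $q_i$ are odd; $q\approx r$ means that $q$ is a rearrangement of $r$. $\Xi^q=\Xi^{D(q)}$ with $D(q)=\{q_1,q_1+q_2,\ldots,q_1+\cdots+q_{k-1}\}$;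 $\Xi^0$ is the empty permutation. The outer product on $\mathcal{D}$ is $\Xi^r\star\Xi^q=\Xi^{r.q}$; the inner product on $\mathcal{D}$ is the product of $KS_n$ on each $\mathcal{D}_n$, extended by $\mathcal{D}_n\mathcal{D}_m=0$ for $n\ne m$. $\mathcal{P}_n\subseteq\mathcal{D}_n$ is the span of the elements $\Pi^P=\sum_{\mathrm{Peak}(\pi)=P}\pi$, $P\subseteq\{2,\ldots,n-1\}$, and $\mathcal{P}=\bigoplus_{n\ge0}\mathcal{P}_n$, which is a subalgebra of $\mathcal{D}$ for both products. $\tilde\Xi^n=2\Pi^\emptyset$ for $n\ge1$, $\tilde\Xi^0$ is the empty permutation, $\tilde\Xi^q=\tilde\Xi^{q_1}\star\cdots\star\tilde\Xi^{q_k}$. $\mathcal{C}=\bigoplus_{n\ge0}\mathrm{Cl}_K(S_n)$, where $\mathrm{Cl}_K(S_n)$ is the ring of $K$-valued class functions on $S_n$ (pointwise product); the inner product on $\mathcal{C}$ is the pointwise product in each degree, with different degrees multiplying to $0$. For $q\in\mathbb{N}^*$ with sum $n$, $\mathsf{char}_q$ is the characteristic function of the class of permutations in $S_n$ whose cycle type is a rearrangement of $q$; $q?=\prod_{i\ge1}a_i!\,i^{a_i}$ with $a_i$ the multiplicity of $i$ in $q$; $\mathsf{ch}_q=q?\,\mathsf{char}_q$. The outer product $\bullet$ on $\mathcal{C}$ is given by $\mathsf{ch}_r\bullet\mathsf{ch}_q=\mathsf{ch}_{r.q}$. $c:(\mathcal{D},\star)\to(\mathcal{C},\bullet)$ is the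 unique algebra homomorphism with $c(\Xi^n)=\xi^n$, the trivial character of $S_n$, for all $n$; by Solomon it is also an algebra epimorphism for the inner products. $\mathcal{C}^{odd}$ is the linear span of all $\mathsf{char}_q$, $q\in\mathbb{N}^*$ odd. $\langle\cdot\rangle_K$ denotes $K$-linear span. *)

(* Defs.v *)
From HB Require Import structures.
From mathcomp Require Import all_boot all_order all_algebra all_fingroup.
From mathcomp.finmap Require Import finmap.
From mathcomp.multinomials Require Import monalg.

Set Implicit Arguments.
Unset Strict Implicit.
Unset Printing Implicit Defensive.

Import GRing.Theory.
Local Open Scope ring_scope.

Definition gperm : choiceType := {n : nat & 'S_n}.
Definition gp n (s : 'S_n) : gperm := Tagged (fun n => 'S_n) s.

(* The direct sum of the group algebras K S_n, n >= 0.  The direct sum of the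
   spaces of functions 'S_n -> K is the same vector space, a function f on 'S_n
   being the element \sum_s f s s; so class functions live here as well. *)
Definition KS (K : fieldType) := {malg K[gperm]}.

Section Spaces.
Variable K : fieldType.
Implicit Types (V W : KS K -> Prop) (x y z : KS K).

Definition lspan V x : Prop :=
  exists (m : nat) (a : 'I_m -> K) (v : 'I_m -> KS K),
    (forall i, V (v i)) /\ x = \sum_(i < m) a i *: v i.

(* For V n contained in degree n, this is the (direct) sum of all the V n. *)
Definition dsum (V : nat -> KS K -> Prop) x : Prop :=
  exists (m : nat) (v : nat -> KS K),
    (forall n, V n (v n)) /\ x = \sum_(n < m) v n.

Definition fun_elt n (f : 'S_n -> K) : KS K :=
  \sum_(s : 'S_n) << f s *g gp s >>.

Definition set_elt n (A : pred 'S_n) : KS K := fun_elt (fun s => (A s)%:R).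

(* MathComp's product of permutations is already read from left to right. *)
Definition gperm_mul (s t : gperm) : KS K :=
  if tag t == tag s then << gp (tagged s * tagged_as s t)%g >> else 0.

Definition inner_perm x y : KS K :=
  \sum_(s <- msupp x) \sum_(t <- msupp y) (x@_s * y@_t) *: gperm_mul s t.

Definition inner_class x y : KS K :=
  \sum_(s <- msupp x) << x@_s * y@_s *g s >>.

End Spaces.

(* The image of i under s, with both positions and values numbered from 1;
   the value outside 1 <= i <= n is irrelevant. *)
Definition img n (s : 'S_n) (i : nat) : nat :=
  if insub i.-1 is Some j then (s j : nat).+1 else 0%N.

(* Subsets of {1, .., n-1} are represented in {set 'I_n}, an ordinal i standing
   for the integer i itself; Des and Peak never contain 0. *)
Definition Des n (s : 'S_n) : {set 'I_n} :=
  [set i : 'I_n | (1 <= i)%N && (img s i > img s i.+1)%N].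

Definition Peak n (s : 'S_n) : {set 'I_n} :=
  [set i : 'I_n | [&& (2 <= i)%N, (img s i.-1 < img s i)%N
                    & (img s i > img s i.+1)%N]].

(* Elements of the free monoid over the positive integers. *)
Definition posword (q : seq nat) : bool := all (fun i => 0 < i)%N q.
Definition oddword (q : seq nat) : bool := all odd q.
Definition odd_composition (n : nat) (q : seq nat) : bool :=
  oddword q && (sumn q == n).
Definition odd_partition (n : nat) (p : seq nat) : bool :=
  sorted geq p && odd_composition n p.

Definition Dset (q : seq nat) : {set 'I_(sumn q)} :=
  [set i : 'I_(sumn q) |
     (i : nat) \in [seq sumn (take j q) | j <- iota 1 (size q).-1]].

Section Algebras.
Variable K : fieldType.
Implicit Types (x y z : KS K) (q r : seq nat).

Definition Delta n (D : {set 'I_n}) : KS K := set_elt K (fun s => Des s == D).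
Definition XiD n (D : {set 'I_n}) : KS K :=
  \sum_(E : {set 'I_n} | E \subset D) Delta E.
Definition Xi q : KS K := XiD (Dset q).

(* Delta D = 0 if D contains 0, and Pi P = 0 if P contains 0 or 1. *)
Definition Dn n : KS K -> Prop :=
  lspan (fun x => exists D : {set 'I_n}, x = Delta D).
Definition Dall : KS K -> Prop := dsum Dn.

Definition Pi n (P : {set 'I_n}) : KS K := set_elt K (fun s => Peak s == P).
Definition Pn n : KS K -> Prop :=
  lspan (fun x => exists P : {set 'I_n}, x = Pi P).
Definition Pall : KS K -> Prop := dsum Pn.

Definition Cn n x : Prop :=
  exists2 f : 'S_n -> K, (forall s t, f (s ^ t)%g = f s) & x = fun_elt f.
Definition Call : KS K -> Prop := dsum Cn.

Definition cycle_type n (s : 'S_n) : seq nat :=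
  [seq #|B| | B : {set 'I_n} <- enum (porbits s)].

Definition char q : KS K :=
  set_elt K (fun s : 'S_(sumn q) => perm_eq (cycle_type s) q).

Definition qfact q : nat :=
  (\prod_(1 <= i < (sumn q).+1) ((count_mem i q)`! * i ^ count_mem i q))%N.

Definition ch q : KS K := (qfact q)%:R *: char q.

Definition triv_char n : KS K := fun_elt (fun _ : 'S_n => 1).

Definition Codd : KS K -> Prop :=
  lspan (fun x => exists2 q, oddword q & x = char q).

Definition linear_on (V : KS K -> Prop) (f : KS K -> KS K) : Prop :=
  forall (a : K) x y, V x -> V y -> f (a *: x + y) = a *: f x + f y.

Definition bilinear_on (V : KS K -> Prop) (mul : KS K -> KS K -> KS K) : Prop :=
  (forall x, V x -> linear_on V (mul x)) /\
  (forall y, V y -> linear_on V (mul^~ y)).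

(* The following three predicates determine the outer products on Dall and on
   Call, and the map c on Dall, because the Xi q (q in N^* ) form a basis of
   Dall and the ch q (q a partition) a basis of Call. *)
Definition is_outer_D (star : KS K -> KS K -> KS K) : Prop :=
  bilinear_on Dall star /\
  (forall r q, posword r -> posword q -> star (Xi r) (Xi q) = Xi (r ++ q)).

Definition is_outer_C (bullet : KS K -> KS K -> KS K) : Prop :=
  bilinear_on Call bullet /\
  (forall r q, posword r -> posword q -> bullet (ch r) (ch q) = ch (r ++ q)).

Definition is_Solomon (star bullet : KS K -> KS K -> KS K)
    (c : KS K -> KS K) : Prop :=
  [/\ forall x, Dall x -> Call (c x),
      linear_on Dall c,
      forall x y, Dall x -> Dall y -> c (star x y) = bullet (c x) (c y),
      c (Xi [::]) = triv_char 0
    & forall n, (0 < n)%N -> c (Xi [:: n]) = triv_char n].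

Definition Xit1 (n : nat) : KS K :=
  if n is 0%N then Xi [::] else 2%:R *: Pi (set0 : {set 'I_n}).

Definition Xit (star : KS K -> KS K -> KS K) q : KS K :=
  foldr star (Xi [::]) [seq Xit1 i | i <- q].

Definition subalgebra (A : KS K -> Prop) (mul : KS K -> KS K -> KS K) : Prop :=
  [/\ A 0,
      forall (a : K) x y, A x -> A y -> A (a *: x + y)
    & forall x y, A x -> A y -> A (mul x y)].

(* Not required to be unital, since the inner products have no unit. *)
Definition algebra_epi (A : KS K -> Prop) (mulA : KS K -> KS K -> KS K)
    (B : KS K -> Prop) (mulB : KS K -> KS K -> KS K)
    (f : KS K -> KS K) : Prop :=
  [/\ subalgebra A mulA /\ subalgebra B mulB,
      forall x, A x -> B (f x),
      linear_on A f,
      forall x y, A x -> A y -> f (mulA x y) = mulB (f x) (f y)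
    & forall y, B y -> exists2 x, A x & f x = y].

End Algebras.

(* Main.v *)
Require Import Defs.
From HB Require Import structures.
From mathcomp Require Import all_boot all_order all_algebra all_fingroup.
From mathcomp.finmap Require Import finmap.
From mathcomp.multinomials Require Import monalg.
From mathcomp Require Import zify ring.

Set Implicit Arguments.
Unset Strict Implicit.
Unset Printing Implicit Defensive.

Import GRing.Theory.
Local Open Scope ring_scope.


(* A product [star] of elements given by functions of the descent word is
   computed blockwise, so [Xit q] is 2 ^+ size q times the sum of the
   permutations without a peak in the interior of any block of q.  Ordering peak
   sets by the sum of their elements, the [Xit q] triangularly generate the peak
   space, and Xit(-t) Xit(t) = 1 removes the even parts.

   Left multiplication by [Xi q] unshuffles words.  Encoding the unshuffled word
   by a labeling of its positions turns the coefficients of [Xi q] * [Xi r] into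
   sums over labelings that split along the blocks of q exactly as the products
   of Young characters do; this gives Solomon's theorem.  With two labels, the
   first read in decreasing and the second in increasing order, the same count
   gives [Xi q] * [Xit n] = [Xit q], so the peak space of degree n is the left
   ideal generated by [Xit n], hence closed under the inner product.

   The relation Xi(-t) Xit(t) = Xi(t) determines the image of [Xit n] as
   \prod (1 - (-1)^x) over the cycle lengths x.  Consequently the image of
   [Xit q] (q odd) is a nonzero multiple of [ch q] plus terms [ch r] with r
   longer than q, and this triangularity yields surjectivity and the kernel. *)

(** [star], [bullet] and [c] are known only through their values on the [Xi q] and [ch q], and only
    inside [Dall] and [Call]; multiplicativity of [c] for the inner products and closure of the peak
    space under them have to be proved. Everything is therefore phrased for functions of the descent
    word ([W]) and of the cycle type ([T]). These take bare sequences, so that degrees add by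
    cutting sequences, without casts between symmetric groups. [star] cuts a word and ignores the
    bit at the junction ([star_W]); [bullet] sums over the splittings of a cycle type ([bullet_T]).
    Hence outer multiplicativity alone carries [c] along any recursion that peels off one block.

    The factor 2 in [Xit1] counts the ways to label a peakless word by a decreasing and an
    increasing part: its lowest letter may go to either. Characteristic 0 is used to divide by
    positive integers such as 2 and [qfact q]. *)

Section LinearSpans.
Variable K : fieldType.
Implicit Types (V S : KS K -> Prop) (x y : KS K).

Definition subspace S : Prop :=
  S 0 /\ forall (a : K) x y, S x -> S y -> S (a *: x + y).

Lemma subspaceZ S a x : subspace S -> S x -> S (a *: x).
Proof. by case=> S0 Sl Sx; rewrite -[_ *: _]addr0; apply: Sl. Qed.

Lemma subspaceD S x y : subspace S -> S x -> S y -> S (x + y).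
Proof. by case=> S0 Sl Sx Sy; rewrite -[x]scale1r; apply: Sl. Qed.

Lemma subspaceB S x y : subspace S -> S x -> S y -> S (x - y).
Proof. by case=> S0 Sl Sx Sy; rewrite addrC -scaleN1r; apply: Sl. Qed.

Lemma subspace_sum S (I : Type) (r : seq I) (P : pred I) (F : I -> KS K) :
  subspace S -> (forall i, P i -> S (F i)) -> S (\sum_(i <- r | P i) F i).
Proof.
move=> sS SF; elim/big_rec: _ => [|i x Pi Sx]; first by case: sS.
by apply: subspaceD => //; apply: SF.
Qed.

Lemma lspan_gen V x : V x -> lspan V x.
Proof.
move=> Vx; exists 1%N, (fun _ => 1), (fun _ => x); split=> //.
by rewrite big_ord1 scale1r.
Qed.

Lemma lspan_subspace V : subspace (lspan V).
Proof.
split=> [|a x y [m [b [v [Vv ->]]]] [p [d [w [Vw ->]]]]].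
  by exists 0%N, (fun _ => 0), (fun _ => 0); split=> [[]//|]; rewrite big_ord0.
exists (m + p)%N,
  (fun i => match split i with inl j => a * b j | inr k => d k end),
  (fun i => match split i with inl j => v j | inr k => w k end).
split=> [i|]; first by case: (split i).
rewrite big_split_ord; congr (_ + _); last first.
  by apply: eq_bigr => i _; rewrite (unsplitK (inr i)).
rewrite scaler_sumr; apply: eq_bigr => i _.
by rewrite (unsplitK (inl i)) scalerA.
Qed.

Lemma lspan_min V S x :
  subspace S -> (forall y, V y -> S y) -> lspan V x -> S x.
Proof.
move=> sS VS [m [a [v [Vv ->]]]]; apply: subspace_sum => // i _.
by apply: subspaceZ => //; apply: VS.
Qed.

Lemma lspan_mono V V' x :
  (forall y, V y -> lspan V' y) -> lspan V x -> lspan V' x.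
Proof. by apply: lspan_min; apply: lspan_subspace. Qed.

Lemma dsum_subspace (V : nat -> KS K -> Prop) :
  (forall n, subspace (V n)) -> subspace (dsum V).
Proof.
move=> sV; split=> [|a x y [m [v [Vv ->]]] [p [w [Vw ->]]]].
  exists 0%N, (fun _ => 0); split=> [n|]; first by case: (sV n).
  by rewrite big_ord0.
(* The two elements come with different truncation bounds; padding with zeros brings both sums to
   length [m + p]. *)
have widen k l (u : nat -> KS K) :
    \sum_(n < k) u n = \sum_(n < k + l) (if (n < k)%N then u n else 0).
  rewrite big_split_ord /= [X in _ + X]big1 ?addr0 => [|i _].
    by apply: eq_bigr => i _; rewrite ltn_ord.
  by rewrite ltnNge leq_addr.
exists (m + p)%N, (fun n => a *: (if (n < m)%N then v n else 0)
                          + (if (n < p)%N then w n else 0)); split=> [n|].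
  have [V0 Vl] := sV n; apply: Vl; case: ifP => // _; exact: Vv || exact: Vw.
by rewrite big_split -scaler_sumr (widen m p) (widen p m) addnC.
Qed.

Lemma dsum_gen (V : nat -> KS K -> Prop) n x :
  (forall k, subspace (V k)) -> V n x -> dsum V x.
Proof.
move=> sV Vx; exists n.+1, (fun k => if k == n then x else 0); split=> [k|].
  by case: eqP => [->//|_]; case: (sV k).
rewrite big_ord_recr /= eqxx big1 ?add0r // => i _.
by rewrite ltn_eqF.
Qed.

Lemma dsum_min (V : nat -> KS K -> Prop) S x :
  subspace S -> (forall n y, V n y -> S y) -> dsum V x -> S x.
Proof. by move=> sS VS [m [v [Vv ->]]]; apply: subspace_sum => // i _; apply/VS/Vv. Qed.

(** * Maps that are linear on a subspace only *)

Section LinearOn.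
Variables (V : KS K -> Prop) (f : KS K -> KS K).
Hypotheses (sV : subspace V) (linf : linear_on V f).

Lemma linear_on0 : f 0 = 0.
Proof.
have [V0 _] := sV; have := linf (-1) V0 V0.
by rewrite scaler0 addr0 scaleN1r addNr.
Qed.

Lemma linear_onZ a x : V x -> f (a *: x) = a *: f x.
Proof.
have [V0 _] := sV => Vx; have := linf a Vx V0.
by rewrite linear_on0 !addr0.
Qed.

Lemma linear_onD x y : V x -> V y -> f (x + y) = f x + f y.
Proof. by move=> Vx Vy; have := linf 1 Vx Vy; rewrite !scale1r. Qed.

Lemma linear_onB x y : V x -> V y -> f (x - y) = f x - f y.
Proof.
by move=> Vx Vy; have := linf (-1) Vy Vx; rewrite !scaleN1r ![- _ + _]addrC.
Qed.

Lemma linear_on_sum (I : Type) (r : seq I) (P : pred I) (F : I -> KS K) :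
  (forall i, P i -> V (F i)) ->
  f (\sum_(i <- r | P i) F i) = \sum_(i <- r | P i) f (F i).
Proof.
move=> VF; suff [] : V (\sum_(i <- r | P i) F i) /\
  f (\sum_(i <- r | P i) F i) = \sum_(i <- r | P i) f (F i) by [].
elim/big_rec2: _ => [|i y x Pi [Vx fx]].
  by split; [case: sV | exact: linear_on0].
split; first by apply: subspaceD => //; apply: VF.
by rewrite linear_onD ?fx //; apply: VF.
Qed.

(** Membership in [V] has to be carried along, because nothing is known about [f] outside [V]. *)
Lemma linear_on_image_subspace S :
  subspace S -> subspace (fun x => V x /\ S (f x)).
Proof.
move=> sS; have [V0 Vl] := sV; have [S0 Sl] := sS.
split=> [|a x y [Vx Sx] [Vy Sy]]; first by rewrite linear_on0.
by split; [apply: Vl | rewrite linf //; apply: Sl].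
Qed.

Lemma linear_on_image_lspan G S x :
  subspace S -> (forall y, G y -> V y /\ S (f y)) -> lspan G x -> S (f x).
Proof.
by move=> sS GS /(lspan_min (linear_on_image_subspace sS) GS) [].
Qed.

End LinearOn.

(** Every closure property under a product below is reduced to generators by this lemma. The left
    factor is varied first, with [y] fixed in [V]; then the right one, with a generator on the
    left. *)
Lemma bilinear_on_lspan V (mul : KS K -> KS K -> KS K) G1 G2 S x y :
  subspace V -> bilinear_on V mul -> subspace S ->
  (forall u, G1 u -> V u) -> (forall v, G2 v -> V v) ->
  (forall u v, G1 u -> G2 v -> S (mul u v)) ->
  lspan G1 x -> lspan G2 y -> S (mul x y).
Proof.
move=> sV [linr linl] sS G1V G2V GS Gx Gy.
have Vy := lspan_min sV G2V Gy.
apply: (linear_on_image_lspan (f := mul^~ y) sV (linl y Vy) sS _ Gx) => u Gu.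
split; first exact: G1V.
apply: (linear_on_image_lspan sV (linr u (G1V u Gu)) sS _ Gy) => v Gv.
by split; [apply: G2V | apply: GS].
Qed.

Lemma linear_on_eq V (f g : KS K -> KS K) G x :
  subspace V -> linear_on V f -> linear_on V g ->
  (forall u, G u -> V u /\ f u = g u) -> lspan G x -> f x = g x.
Proof.
move=> sV lf lg GS Gx.
suff [] : V x /\ f x = g x by [].
apply: (lspan_min (S := fun x => V x /\ f x = g x)) Gx => //; have [V0 Vl] := sV.
split=> [|a u v [Vu fu] [Vv fv]]; first by rewrite (linear_on0 sV lf) (linear_on0 sV lg).
by split; [apply: Vl | rewrite lf // lg // fu fv].
Qed.

End LinearSpans.

(** * Coefficients of elements and the two inner products *)

Section Coefficients.
Variable K : fieldType.
Implicit Types (x y z : KS K) (g : gperm).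

Lemma gp_inj n : injective (@gp n).
Proof. by move=> s t /eqP; rewrite eq_Tagged => /eqP. Qed.

Lemma mcoeff_fun_elt n (f : 'S_n -> K) (s : 'S_n) : (fun_elt f)@_(gp s) = f s.
Proof.
rewrite /fun_elt raddf_sum /= (bigD1 s) //= mcoeffU eqxx mulr1n big1 ?addr0 //.
by move=> t ts; rewrite mcoeffU (inj_eq (@gp_inj n)) (negPf ts).
Qed.

Lemma mcoeff_fun_elt_neq n (f : 'S_n -> K) g : tag g != n -> (fun_elt f)@_g = 0.
Proof.
move=> gn; rewrite /fun_elt raddf_sum /= big1 // => t _; rewrite mcoeffU.
by rewrite (_ : (_ == _) = false) //; apply: contraNF gn => /eqP<-.
Qed.

(* Taking the whole family [f] avoids a cast from ['S_(tag g)] to ['S_n]. *)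
Lemma mcoeff_fun_elt_tag n (f : forall m, 'S_m -> K) g :
  (fun_elt (f n))@_g = (tag g == n)%:R * f _ (tagged g).
Proof.
case: g => m s /=; have [<-|mn] := eqVneq m n.
  by rewrite mul1r (mcoeff_fun_elt (f m)).
by rewrite mul0r mcoeff_fun_elt_neq.
Qed.

Lemma fun_elt_ext n (f h : 'S_n -> K) : f =1 h -> fun_elt f = fun_elt h.
Proof. by move=> fh; rewrite /fun_elt; apply: eq_bigr => s _; rewrite fh. Qed.

Lemma fun_elt_lin n (a : K) (f h : 'S_n -> K) :
  fun_elt (fun s => a * f s + h s) = a *: fun_elt f + fun_elt h.
Proof.
apply/malgP => -[m s]; rewrite mcoeffD mcoeffZ.
have [e|mn] := eqVneq m n; first by case: n / e f h => f h; rewrite !mcoeff_fun_elt.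
by rewrite !mcoeff_fun_elt_neq ?mulr0 ?addr0.
Qed.

Lemma inner_class_coef x y g : (inner_class x y)@_g = x@_g * y@_g.
Proof.
rewrite /inner_class raddf_sum /=.
have [gx|gx] := boolP (g \in msupp x); last first.
  rewrite (mcoeff_outdom gx) mul0r big_seq big1 // => s sx.
  by rewrite mcoeffU (_ : (_ == _) = false) //; apply: contraNF gx => /eqP<-.
rewrite (bigD1_seq g) ?fset_uniq //= mcoeffU eqxx mulr1n big1 ?addr0 // => s sg.
by rewrite mcoeffU (negPf sg).
Qed.

(** The defining sum runs over supports, which are not additive in [x] and [y]; over fixed larger
    sets the expression is visibly bilinear. *)
Lemma inner_permEw (d1 d2 : {fset gperm}) x y :
  (msupp x `<=` d1)%fset -> (msupp y `<=` d2)%fset ->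
  inner_perm x y =
  \sum_(s <- d1) \sum_(t <- d2) (x@_s * y@_t) *: gperm_mul K s t.
Proof.
move=> xd yd; rewrite /inner_perm (big_fset_incl _ xd) /= => [|s _ sx].
  apply: eq_bigr => s _; rewrite (big_fset_incl _ yd) //= => t _ ty.
  by rewrite (mcoeff_outdom ty) mulr0 scale0r.
by rewrite big1 // => t _; rewrite (mcoeff_outdom sx) mul0r scale0r.
Qed.

Lemma inner_perm_bilinear V : bilinear_on V (@inner_perm K).
Proof.
split=> u _ a x y _ _ /=.
  have le3 w : w \in [:: x; y; a *: x + y] ->
      (msupp w `<=` msupp x `|` msupp y `|` msupp (a *: x + y))%fset.
    by rewrite !inE => /or3P[] /eqP->; apply/fsubsetP => s; rewrite !inE => ->; rewrite ?orbT.
  rewrite !(@inner_permEw (msupp u) _ _ _ (fsubset_refl _) (le3 _ _)) ?inE ?eqxx ?orbT //.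
  rewrite scaler_sumr -big_split; apply: eq_bigr => s _.
  rewrite scaler_sumr -big_split; apply: eq_bigr => t _ /=.
  by rewrite mcoeffD mcoeffZ scalerA -scalerDl mulrDr mulrCA.
have le3 w : w \in [:: x; y; a *: x + y] ->
    (msupp w `<=` msupp x `|` msupp y `|` msupp (a *: x + y))%fset.
  by rewrite !inE => /or3P[] /eqP->; apply/fsubsetP => s; rewrite !inE => ->; rewrite ?orbT.
rewrite !(@inner_permEw _ (msupp u) _ _ (le3 _ _) (fsubset_refl _)) ?inE ?eqxx ?orbT //.
rewrite scaler_sumr -big_split; apply: eq_bigr => s _.
rewrite scaler_sumr -big_split; apply: eq_bigr => t _ /=.
by rewrite mcoeffD mcoeffZ scalerA -scalerDl mulrDl mulrA.
Qed.

Lemma inner_class_bilinear V : bilinear_on V (@inner_class K).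
Proof.
split=> u _ a x y _ _ /=; apply/malgP => g.
  by rewrite mcoeffD mcoeffZ !inner_class_coef mcoeffD mcoeffZ mulrDr mulrCA.
by rewrite mcoeffD mcoeffZ !inner_class_coef mcoeffD mcoeffZ mulrDl mulrA.
Qed.

Lemma subspaceT : subspace (fun _ : KS K => True).
Proof. by []. Qed.

Lemma inner_permU m n (s : 'S_m) (t : 'S_n) :
  inner_perm << gp s >> << gp t >> = gperm_mul K (gp s) (gp t).
Proof.
by rewrite /inner_perm !msuppU !oner_eq0 !big_seq_fset1 !mcoeffUU mulr1 scale1r.
Qed.

Lemma fun_eltE n (f : 'S_n -> K) : fun_elt f = \sum_(s : 'S_n) f s *: << gp s >>.
Proof.
apply: eq_bigr => s _; apply/malgP => g.
by rewrite mcoeffZ !mcoeffU mulrnAr mulr1.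
Qed.

Lemma inner_perm_fun_elt_gen m n (f : 'S_m -> K) (h : 'S_n -> K) :
  inner_perm (fun_elt f) (fun_elt h) =
  \sum_(s : 'S_m) \sum_(t : 'S_n) (f s * h t) *: gperm_mul K (gp s) (gp t).
Proof.
have [linr linl] := inner_perm_bilinear (fun _ => True).
rewrite (fun_eltE f) (linear_on_sum subspaceT (linl _ I)) //; apply: eq_bigr => s _.
rewrite (linear_onZ subspaceT (linl _ I)) // (fun_eltE h).
rewrite (linear_on_sum subspaceT (linr _ I)) // scaler_sumr; apply: eq_bigr => t _.
by rewrite (linear_onZ subspaceT (linr _ I)) // inner_permU scalerA.
Qed.

Lemma inner_perm_fun_elt_neq m n (f : 'S_m -> K) (h : 'S_n -> K) :
  m != n -> inner_perm (fun_elt f) (fun_elt h) = 0.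
Proof.
move=> mn; rewrite inner_perm_fun_elt_gen big1 // => s _; rewrite big1 // => t _.
by rewrite /gperm_mul /= eq_sym (negPf mn) scaler0.
Qed.

Lemma inner_perm_fun_elt n (f h : 'S_n -> K) :
  inner_perm (fun_elt f) (fun_elt h) =
  fun_elt (fun t : 'S_n => \sum_s f s * h (s^-1 * t)%g).
Proof.
rewrite inner_perm_fun_elt_gen fun_eltE exchange_big /=.
rewrite exchange_big /=.
under [RHS]eq_bigr => t _ do rewrite scaler_suml.
rewrite [RHS]exchange_big /=; apply: eq_bigr => s _.
rewrite (reindex_inj (mulgI (s^-1)%g)) /=; apply: eq_bigr => t _.
by rewrite /gperm_mul /= eqxx tagged_asE mulKVg.
Qed.

(** Needed in [Pall_inner], where a product of two peak elements is regrouped so that [Xit1 n]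
    becomes its right factor. *)
Lemma inner_perm_fun_eltA n (f h k : 'S_n -> K) :
  inner_perm (fun_elt f) (inner_perm (fun_elt h) (fun_elt k)) =
  inner_perm (inner_perm (fun_elt f) (fun_elt h)) (fun_elt k).
Proof.
rewrite !inner_perm_fun_elt; apply: fun_elt_ext => t.
under eq_bigr => s _ do rewrite mulr_sumr (reindex_inj (mulgI (s^-1)%g)) /=.
rewrite exchange_big; apply: eq_bigr => r _ /=.
rewrite mulr_suml; apply: eq_bigr => s _.
by rewrite mulrA invMg invgK -mulgA mulKVg.
Qed.

End Coefficients.

(** * Descent sets, peak sets and compositions in terms of bit words *)

Section DescentWords.

(* Bit [j] tells whether there is a descent between positions [j.+1] and
   [j.+2], in the 1-based numbering of [img]. *)
Definition dword n (s : 'S_n) : bitseq :=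
  mkseq (fun j => img s j.+2 < img s j.+1)%N n.-1.

Lemma size_dword n (s : 'S_n) : size (dword s) = n.-1.
Proof. exact: size_mkseq. Qed.

Lemma nth_dword n (s : 'S_n) j :
  nth false (dword s) j = (j < n.-1)%N && (img s j.+2 < img s j.+1)%N.
Proof.
case: ltnP => [lt_j|le_j]; first by rewrite nth_mkseq.
by rewrite nth_default ?size_dword.
Qed.

Lemma imgE n (s : 'S_n) (i : 'I_n) : img s i.+1 = (s i).+1.
Proof. by rewrite /img; case: insubP => [j _ /val_inj->|]; rewrite ?ltn_ord. Qed.

Lemma img_inj n (s : 'S_n) i j :
  (i < n)%N -> (j < n)%N -> img s i.+1 = img s j.+1 -> i = j.
Proof.
move=> lt_i lt_j; rewrite (imgE s (Ordinal lt_i)) (imgE s (Ordinal lt_j)).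
by move=> [] /val_inj /perm_inj [].
Qed.

Lemma nth_dword_ord n (s : 'S_n) (i j : 'I_n) :
  j = i.+1 :> nat -> nth false (dword s) i = (s j < s i)%N.
Proof.
move=> ji; by rewrite nth_dword ltn_predRL imgE -ji imgE ltnS ltn_ord.
Qed.

Definition desw n (w : bitseq) : {set 'I_n} :=
  [set i : 'I_n | (1 <= i)%N && nth false w i.-1].

Definition pkw n (w : bitseq) : {set 'I_n} :=
  [set i : 'I_n | [&& (2 <= i)%N, ~~ nth false w i.-2 & nth false w i.-1]].

Lemma Des_dword n (s : 'S_n) : Des s = desw n (dword s).
Proof.
apply/setP => i; rewrite !inE; case: i => -[|i] //= lt_i.
by rewrite nth_dword ltn_predRL lt_i.
Qed.

Lemma Peak_dword n (s : 'S_n) : Peak s = pkw n (dword s).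
Proof.
apply/setP => i; rewrite !inE; case: i => -[|[|i]] //= lt_i.
have lt1 : (i.+1 < n.-1)%N by rewrite ltn_predRL.
rewrite !nth_dword lt1 (ltn_trans _ lt1) // /= -leqNgt; congr (_ && _).
(* The absence of a descent gives only a weak inequality; equality is excluded by injectivity. *)
rewrite [RHS]leq_eqVlt; case: eqP => // e; have /eqP := img_inj (ltn_trans (ltnSn _) (ltnW lt_i)) (ltnW lt_i) e.
by rewrite -(inj_eq succn_inj) ltn_eqF.
Qed.

(* The descents encoded by [w] lie among the partial sums of [q]; zero entries
   of [q] have no effect, since [take 0.-1 w] is empty. *)
Fixpoint inclb (w : bitseq) (q : seq nat) : bool :=
  if q is x :: q' then all negb (take x.-1 w) && inclb (drop x w) q' else true.

(** The size bound matters: the last block [x] inspects only [x.-1] bits, so descents of a longer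
    word could go unseen by [inclb]. *)
Lemma inclbP w q : posword q -> (size w <= (sumn q).-1)%N ->
  reflect (forall j, nth false w j ->
             j.+1 \in [seq sumn (take i q) | i <- iota 1 (size q).-1])
          (inclb w q).
Proof.
have all_take k (v : bitseq) :
    reflect (forall j, (j < k)%N -> ~~ nth false v j) (all negb (take k v)).
  apply: (iffP (all_nthP false)) => [H j lt_j | H j].
    have [lt_jv|le_vj] := ltnP j (size v); last by rewrite nth_default.
    by have := H j; rewrite size_take_min nth_take // leq_min lt_j lt_jv => ->.
  rewrite size_take_min leq_min => /andP[lt_j _]; rewrite nth_take //; exact: H.
elim: q w => [|x q IHq] w /=; first by rewrite leqn0 size_eq0 => _ /eqP->; left=> j; rewrite nth_nil.
move=> /andP[x_gt0 pos_q] size_w.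
case: q IHq pos_q size_w => [|y q] IHq pos_q size_w.
  rewrite andbT /=; apply: (iffP (all_take _ _)) => [H j wj|H j lt_j].
    have : (j < x.-1)%N.
      rewrite addn0 in size_w; apply: leq_trans size_w; rewrite ltnNge.
      by apply: contraL wj => le_j; rewrite nth_default.
    by move/H; rewrite wj.
  by apply/negP => /H.
have -> : [seq sumn (take i (x :: y :: q)) | i <- iota 1 (size q).+1] =
   x :: [seq (x + k)%N | k <- [seq sumn (take i (y :: q)) | i <- iota 1 (size q)]].
  rewrite [iota 1 _]/= /= addn0; congr (_ :: _); rewrite -map_comp.
  by rewrite (iotaDl 1 1) -map_comp; apply: eq_map => i.
have sw : (size (drop x w) <= (sumn (y :: q)).-1)%N.
  by rewrite size_drop; move: size_w => /=; case/andP: pos_q; lia.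
apply: (iffP andP) => [[/all_take H1 /(IHq _ pos_q sw) H2] j wj|H].
  have [lt_j|le_j] := ltnP j x; last first.
    rewrite inE -(subnKC le_j) -addnS mem_map ?orbT; last exact: addnI.
    by rewrite H2 ?orbT // nth_drop subnKC.
  rewrite inE eqn_leq lt_j /= leqNgt.
  suff -> : ~~ (j.+1 < x)%N by [].
  by apply/negP; rewrite -ltnS => lt_jx; have := H1 j; rewrite wj -ltnS prednK // => /(_ lt_jx).
split; [apply/all_take => j lt_j | apply/(IHq _ pos_q sw) => j].
  apply/negP => /H; rewrite inE => /orP[/eqP e|/mapP[k _ e]].
    by move: lt_j; rewrite -e ltnn.
  by move: lt_j; rewrite -ltnS prednK // e ltnNge leq_addr.
rewrite nth_drop => /H; rewrite inE -addnS -[X in _ == X]addn0 eqn_add2l /=.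
by rewrite mem_map //; apply: addnI.
Qed.

Lemma inclb_cat w q r : posword q ->
  inclb w (q ++ r) = inclb (take (sumn q).-1 w) q && inclb (drop (sumn q) w) r.
Proof.
elim: q w => [|x q IHq] w /=; first by rewrite drop0.
case/andP=> x_gt0 pos_q; rewrite IHq // drop_drop andbA [(sumn q + x)%N]addnC.
rewrite -take_min (_ : minn _ _ = x.-1); last by lia.
case: q pos_q {IHq} => //= y q /andP[y_gt0 _]; rewrite take_drop.
by rewrite (_ : (y + sumn q).-1 + x = (x + (y + sumn q)).-1)%N //; lia.
Qed.

(** A set bit closes a block, so the set bits of [v] mark the proper partial sums of [wcomp v]. By
    [wcomp_surj] every nonempty composition arises in this way. *)
Fixpoint wcomp (v : bitseq) : seq nat :=
  if v is b :: v' then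
    if b then 1%N :: wcomp v' else (head 0%N (wcomp v')).+1 :: behead (wcomp v')
  else [:: 1%N].

Lemma wcomp_cons v : wcomp v = head 0%N (wcomp v) :: behead (wcomp v).
Proof. by case: v => [|[] v]. Qed.

Lemma wcomp_pos v : posword (wcomp v).
Proof.
elim: v => //= -[] v IHv //=.
by move: IHv; rewrite wcomp_cons /= => /andP[].
Qed.

Lemma sumn_wcomp v : sumn (wcomp v) = (size v).+1.
Proof. by elim: v => //= -[] v /=; [move=> ->|rewrite wcomp_cons /= addSn => ->]. Qed.

Lemma wcomp_head v : head 0%N (wcomp v) = (head 0%N (wcomp v)).-1.+1.
Proof. by have := wcomp_pos v; rewrite wcomp_cons => /andP[/prednK]. Qed.

Lemma inclb_wcomp w v : size w = size v -> inclb w (wcomp v) = all2 implb w v.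
Proof.
elim: v w => [|[] v IHv] [|b w] //= [sw]; rewrite ?implybT ?drop0 ?IHv //.
by rewrite -IHv // wcomp_cons wcomp_head /= implybF andbA.
Qed.

End DescentWords.

(** * The descent algebra as the space of functions of the descent word *)

Section WordFunctions.
Variable K : fieldType.
Implicit Types (phi psi : bitseq -> K).

Definition W n phi : KS K := fun_elt (fun s : 'S_n => phi (dword s)).

Lemma W_coef n phi (g : gperm) :
  (W n phi)@_g = (tag g == n)%:R * phi (dword (tagged g)).
Proof. exact: (mcoeff_fun_elt_tag n (fun m s => phi (@dword m s))). Qed.

Lemma W_ext n phi psi :
  (forall w, size w = n.-1 -> phi w = psi w) -> W n phi = W n psi.
Proof. by move=> e; apply: fun_elt_ext => s; rewrite e ?size_dword. Qed.

Lemma W_lin n a phi psi :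
  W n (fun w => a * phi w + psi w) = a *: W n phi + W n psi.
Proof. exact: fun_elt_lin. Qed.

Lemma W0 n : W n (fun=> 0) = 0.
Proof. by apply/malgP => g; rewrite W_coef mulr0 mcoeff0. Qed.

Lemma WZ n a phi : W n (fun w => a * phi w) = a *: W n phi.
Proof.
rewrite -[RHS]addr0 -(W0 n) -W_lin.
by apply: W_ext => w _; rewrite addr0.
Qed.

Lemma WD n phi psi : W n (fun w => phi w + psi w) = W n phi + W n psi.
Proof.
rewrite -[W n phi in RHS]scale1r -W_lin.
by apply: W_ext => w _; rewrite mul1r.
Qed.

Lemma W_sum n (I : Type) (r : seq I) (P : pred I) (F : I -> bitseq -> K) :
  W n (fun w => \sum_(i <- r | P i) F i w) = \sum_(i <- r | P i) W n (F i).
Proof.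
elim: r => [|i r IHr].
  rewrite big_nil -(W0 n); apply: W_ext => w _; exact: big_nil.
rewrite big_cons -IHr; case: ifP => Pi; rewrite -?WD;
  by apply: W_ext => w _; rewrite big_cons Pi.
Qed.

Lemma Delta_W n (D : {set 'I_n}) :
  Delta K D = W n (fun w => (desw n w == D)%:R).
Proof. by apply: fun_elt_ext => s; rewrite Des_dword. Qed.

Lemma Pi_W n (P : {set 'I_n}) : Pi K P = W n (fun w => (pkw n w == P)%:R).
Proof. by apply: fun_elt_ext => s; rewrite Peak_dword. Qed.

Lemma XiD_W n (D : {set 'I_n}) :
  XiD K D = W n (fun w => (desw n w \subset D)%:R).
Proof.
rewrite /XiD (eq_bigr _ (fun E _ => Delta_W E)) -W_sum; apply: W_ext => w _.
have [sD|nsD] := boolP (desw n w \subset D).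
  rewrite (bigD1 (desw n w)) //= eqxx big1 ?addr0 // => E /andP[_].
  by rewrite eq_sym => /negPf->.
by rewrite big1 // => E sE; case: eqP sE nsD => // -> ->.
Qed.

Lemma Xi_W q : posword q -> Xi K q = W (sumn q) (fun w => (inclb w q)%:R).
Proof.
move=> pos_q; rewrite /Xi XiD_W; apply: W_ext => w size_w; congr ((_ : bool)%:R).
have le_w : (size w <= (sumn q).-1)%N by rewrite size_w.
have incP := inclbP pos_q le_w.
apply/subsetP/incP.
  move=> H j wj; have lt_j : (j < (sumn q).-1)%N.
    by rewrite -size_w ltnNge; apply: contraL wj => le_j; rewrite nth_default.
  rewrite ltn_predRL in lt_j.
  by have := H (Ordinal lt_j); rewrite !inE /= => -> //; rewrite wj.
by move=> H i; rewrite !inE => /andP[i_gt0 /H]; rewrite prednK.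
Qed.

(** Moebius inversion on the Boolean lattice, one bit at a time: [phi (b :: w)] is [phi (true :: w)]
    plus, for [b = false] only, the difference of the two values. *)
Lemma word_span m phi : exists s : seq (K * bitseq),
  (forall p, p \in s -> size p.2 = m) /\
  forall w, size w = m -> phi w = \sum_(p <- s) p.1 * (all2 implb w p.2)%:R.
Proof.
elim: m phi => [|m IHm] phi.
  exists [:: (phi [::], [::])]; split=> [p|[] // _]; first by rewrite inE => /eqP->.
  by rewrite big_seq1 mulr1.
have [s1 [size1 eq1]] := IHm (fun w => phi (false :: w) - phi (true :: w)).
have [s2 [size2 eq2]] := IHm (fun w => phi (true :: w)).
exists ([seq (p.1, false :: p.2) | p <- s1] ++ [seq (p.1, true :: p.2) | p <- s2]).
split=> [p|[|b w] //= [size_w]].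
  by rewrite mem_cat => /orP[] /mapP[p' ps ->] /=; rewrite ?(size1 _ ps) ?(size2 _ ps).
rewrite big_cat !big_map /=; under [X in _ + X]eq_bigr => p _ do rewrite implybT.
rewrite -eq2 //; case: b => /=; last by rewrite -eq1 // subrK.
by rewrite big1 ?add0r // => p _; rewrite mulr0.
Qed.

Definition composition n q := posword q && (sumn q == n).

Lemma composition_cat n m q r :
  composition n q -> composition m r -> composition (n + m) (q ++ r).
Proof.
move=> /andP[pq /eqP sq] /andP[pr /eqP sr].
by rewrite /composition /posword all_cat sumn_cat sq sr eqxx andbT; apply/andP.
Qed.

Lemma comp_span n phi : exists s : seq (K * seq nat),
  (forall p, p \in s -> composition n p.2) /\
  forall w, size w = n.-1 -> phi w = \sum_(p <- s) p.1 * (inclb w p.2)%:R.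
Proof.
case: n => [|n].
  exists [:: (phi [::], [::])]; split=> [p|w /size0nil->].
    by rewrite inE => /eqP->.
  by rewrite big_seq1 mulr1.
have [s [size_s eq_s]] := word_span n phi.
exists [seq (p.1, wcomp p.2) | p <- s]; split=> [_ /mapP[p ps ->]|w size_w] /=.
  by rewrite /composition wcomp_pos sumn_wcomp size_s ?eqxx.
rewrite big_map eq_s // !big_seq; apply: eq_bigr => p ps.
by rewrite inclb_wcomp // size_s.
Qed.

Lemma Xi_comp n q : composition n q -> Xi K q = W n (fun w => (inclb w q)%:R).
Proof. by case/andP=> pos_q /eqP<-; apply: Xi_W. Qed.

Lemma W_Xi_span n phi :
  lspan (fun x => exists2 q, composition n q & x = Xi K q) (W n phi).
Proof.
have [s [comp_s eq_s]] := comp_span n phi.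
rewrite (W_ext eq_s) W_sum big_seq; apply: subspace_sum; first exact: lspan_subspace.
move=> p ps; rewrite WZ -Xi_comp ?comp_s //.
apply: subspaceZ; first exact: lspan_subspace.
by apply: lspan_gen; exists p.2; rewrite ?comp_s.
Qed.

Lemma W_subspace n : subspace (fun x => exists phi, x = W n phi).
Proof.
split=> [|a _ _ [f ->] [h ->]]; first by exists (fun=> 0); rewrite W0.
by rewrite -W_lin; eexists.
Qed.

Lemma DnP n x : Dn n x <-> exists phi, x = W n phi.
Proof.
split=> [|[phi ->]].
  by apply: (lspan_min (W_subspace n)) => _ [D ->]; rewrite Delta_W; eexists.
(* A left inverse of [desw] on words of size [n.-1], used to turn [phi] into coefficients of the
   [Delta D]. *)
pose wd (D : {set 'I_n}) := mkseq (fun j => [exists i in D, i == j.+1 :> nat]) n.-1.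
have desK w : size w = n.-1 -> wd (desw n w) = w.
  move=> size_w; apply: (@eq_from_nth _ false); rewrite size_mkseq // => j lt_j.
  rewrite nth_mkseq //; have lt_jn : (j.+1 < n)%N by rewrite -ltn_predRL.
  apply/exists_inP/idP => [[i]|wj].
    by rewrite !inE => /andP[_ wi] /eqP e; rewrite e in wi.
  by exists (Ordinal lt_jn); rewrite ?inE.
have -> : W n phi = \sum_(D : {set 'I_n}) phi (wd D) *: Delta K D.
  under eq_bigr => D _ do rewrite Delta_W -WZ.
  rewrite -W_sum; apply: W_ext => w size_w.
  rewrite (bigD1 (desw n w)) //= desK // eqxx mulr1 big1 ?addr0 // => D.
  by rewrite eq_sym => /negPf->; rewrite mulr0.
apply: subspace_sum => [|D _]; first exact: lspan_subspace.
by apply: subspaceZ; [exact: lspan_subspace | apply: lspan_gen; exists D].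
Qed.

Lemma Dn_subspace n : subspace (@Dn K n). Proof. exact: lspan_subspace. Qed.

Lemma Dall_subspace : subspace (@Dall K).
Proof. exact/dsum_subspace/Dn_subspace. Qed.

Lemma Dall_W n phi : Dall (W n phi).
Proof. by apply: (dsum_gen (n := n)) => //; [exact: Dn_subspace | apply/DnP; exists phi]. Qed.

Lemma Dall_Xi q : posword q -> Dall (Xi K q).
Proof. by move/Xi_W->; apply: Dall_W. Qed.

Lemma Dall_span x : Dall x -> lspan (fun x => exists2 q, posword q & x = Xi K q) x.
Proof.
apply: dsum_min => [|n y /DnP[phi ->]]; first exact: lspan_subspace.
apply: lspan_mono (W_Xi_span n phi) => _ [q /andP[pos_q _] ->].
by apply: lspan_gen; exists q.
Qed.

End WordFunctions.

(** * The outer product of functions of the descent word *)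

Section OuterProduct.
Variables (K : fieldType) (star : KS K -> KS K -> KS K).
Hypothesis Hstar : is_outer_D star.

(** Both sides are bilinear in [phi] and [psi], and for the indicators of [inclb] the formula is
    [inclb_cat]. Bit [n.-1], at the junction of the blocks, is read by neither factor. *)
Lemma star_W n m (phi psi : bitseq -> K) :
  star (W n phi) (W m psi) =
  W (n + m) (fun w => phi (take n.-1 w) * psi (drop n w)).
Proof.
have [[linr linl] starXi] := Hstar.
have [s [comp_s eq_s]] := comp_span n phi.
have [t [comp_t eq_t]] := comp_span m psi.
have DW := @Dall_W K; have sD := @Dall_subspace K.
have -> : W n phi = \sum_(p <- s) p.1 *: W n (fun w => (inclb w p.2)%:R).
  by rewrite (W_ext eq_s) W_sum; apply: eq_bigr => p _; rewrite WZ.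
have -> : W m psi = \sum_(p <- t) p.1 *: W m (fun w => (inclb w p.2)%:R).
  by rewrite (W_ext eq_t) W_sum; apply: eq_bigr => p _; rewrite WZ.
have DZ (a : K) k (f : bitseq -> K) : Dall (a *: W k f) by exact: subspaceZ sD (DW k f).
have Dt : Dall (\sum_(p <- t) p.1 *: W m (fun w => (inclb w p.2)%:R)).
  by apply: subspace_sum => // i _; apply: DZ.
rewrite (linear_on_sum sD (linl _ Dt)) //.
under eq_bigr => p _.
  rewrite (linear_on_sum sD (linr _ _)) //.
  under eq_bigr => r _.
    rewrite (linear_onZ sD (linr _ _)) // (linear_onZ sD (linl _ _)) //.
    over.
  over.
transitivity (W (n + m) (fun w => \sum_(p <- s) \sum_(r <- t) r.1 *
   (p.1 * (inclb w (p.2 ++ r.2))%:R))).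
  rewrite W_sum big_seq [RHS]big_seq; apply: eq_bigr => p ps.
  rewrite W_sum big_seq [RHS]big_seq; apply: eq_bigr => r rt.
  rewrite !WZ -!Xi_comp ?comp_s ?comp_t //; last first.
    exact: composition_cat (comp_s p ps) (comp_t r rt).
  by rewrite starXi //; [case/andP: (comp_s p ps)|case/andP: (comp_t r rt)].
apply: W_ext => w size_w.
have size_t : size (take n.-1 w) = n.-1 by rewrite size_take_min size_w; lia.
have size_d : size (drop n w) = m.-1 by rewrite size_drop size_w; lia.
rewrite eq_s // eq_t //.
rewrite mulr_suml big_seq [RHS]big_seq; apply: eq_bigr => p ps.
rewrite mulr_sumr; apply: eq_bigr => r _.
have /andP[pos_p /eqP sum_p] := comp_s p ps.
by rewrite inclb_cat // sum_p -mulnb natrM; ring.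
Qed.

End OuterProduct.

(** * Peakless words and the coefficients of the elements [Xit q] *)

Section ValleyWords.

(* The descent words [1..10..0] of the permutations without peaks. *)
Definition valley (w : bitseq) : bool := sorted (fun a b => b ==> a) w.

#[global] Arguments valley : simpl never.

Lemma valley_cons b w : valley (b :: w) = (head false w ==> b) && valley w.
Proof. by case: w. Qed.

Lemma valley_true w : valley (true :: w) = valley w.
Proof. by rewrite valley_cons implybT. Qed.

Lemma valley_false w : valley (false :: w) = all negb w.
Proof.
elim: w => //= b w; rewrite /valley /= => IH.
by case: b => //=; exact: IH.
Qed.

(** A peak of [w] is an ascent bit followed by a descent bit. It is interior to a block of [wcomp v]
    unless one of the two bits is a block boundary, so the test demands such a boundary at every
    peak. *)
Fixpoint peaks_in (v w : bitseq) : bool :=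
  match v, w with
  | a :: v', b :: w' =>
      ((~~ b && head false w') ==> (a || head false v')) && peaks_in v' w'
  | _, _ => true
  end.

Lemma peaks_inP v w : size w = size v ->
  reflect (forall j, ~~ nth false w j -> nth false w j.+1 ->
             nth false v j || nth false v j.+1) (peaks_in v w).
Proof.
elim: v w => [|a v IHv] [|b w] //=; first by left=> j; rewrite !nth_nil.
case=> sw; apply: (iffP andP) => [[/implyP H1 /(IHv _ sw) H2] [|j] wj wj1|H].
- by move: H1; rewrite -!nth0; apply; rewrite wj.
- exact: H2.
split; first by apply/implyP; rewrite -!nth0 => /andP[b0 w0]; exact: (H 0%N).
by apply/(IHv _ sw) => j wj wj1; apply: (H j.+1).
Qed.

Variable K : fieldType.

Definition theta1 n (w : bitseq) : K := if n is 0%N then 1 else 2 * (valley w)%:R.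

Fixpoint theta (q : seq nat) (w : bitseq) : K :=
  if q is x :: q' then theta1 x (take x.-1 w) * theta q' (drop x w) else 1.

Lemma theta_wcomp v w : size w = size v ->
  theta (wcomp v) w = 2 ^+ size (wcomp v) * (peaks_in v w)%:R.
Proof.
elim: v w => [|a v IHv] [|b w] //=; first by rewrite /theta1 /valley /= !mulr1.
case=> sw; have IH := IHv w sw; case: a => /=.
  by rewrite drop0 IH implybT exprS mulr1 mulrA.
set y := (head 0%N (wcomp v)).-1; have hE : head 0%N (wcomp v) = y.+1 by exact: wcomp_head.
move: IH; rewrite {1 2}wcomp_cons hE /= valley_cons => IH.
(* Joining one more position to the first block adds a single condition, on its first two bits. The
   second bit is the head of [w], unless the block stops there, that is [y = 0]. *)
have -> : (head false (take y w) ==> b) = (~~ b && head false w ==> head false v).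
  rewrite /y; case: v w sw {y hE IHv IH} => [|[] v] [|c w] //= _.
  - by case: b.
  - by rewrite implybT.
  - by rewrite wcomp_head /=; case: b; case: c.
move: (_ ==> _) IH => c; case: c => /= IH; first by rewrite IH.
by rewrite !mulr0 mul0r.
Qed.

Lemma wcomp_surj q : posword q -> q != [::] -> exists v, wcomp v = q.
Proof.
elim: q => //= x q IHq /andP[x_gt0 pos_q] _.
have wn k v : wcomp (nseq k false ++ v) = (k + head 0%N (wcomp v))%N :: behead (wcomp v).
  by elim: k => [|k IHk] /=; [exact: wcomp_cons | rewrite IHk].
have [q0|q_n0] := eqVneq q [::].
  by exists (nseq x.-1 false ++ [::]); rewrite wn q0 /= addn1 prednK.
have [v <-] := IHq pos_q q_n0.
by exists (nseq x.-1 false ++ true :: v); rewrite wn /= addn1 prednK.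
Qed.

(* The signed sums below are the generating series identities
   Xi(-t) Xit(t) = Xi(t) and Xit(-t) Xit(t) = 1, read on descent words. *)
Lemma sum_incr_valley w :
  \sum_(j < size w) (-1) ^+ j * ((all negb (take j w))%:R * (valley (drop j.+1 w))%:R)
  = (valley w)%:R - (~~ odd (size w))%:R * (all negb w)%:R :> K.
Proof.
elim: w => [|b w IHw]; first by rewrite big_ord0 /= mul1r subrr.
rewrite big_ord_recl /= drop0 expr0 !mul1r; case: b => /=.
  by rewrite big1 ?valley_true ?mulr0 ?subr0 ?addr0 // => i _; rewrite mul0r mulr0.
under eq_bigr => i _ do rewrite exprS mulN1r mulNr.
by rewrite sumrN IHw valley_false; case: (odd _) => /=; ring.
Qed.

Lemma sum_valley_valley w :
  \sum_(j < size w) (-1) ^+ j * ((valley (take j w))%:R * (valley (drop j.+1 w))%:R)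
  = (odd (size w))%:R * (valley w)%:R :> K.
Proof.
elim: w => [|b w IHw]; first by rewrite big_ord0 mul0r.
rewrite big_ord_recl /= drop0 expr0 !mul1r; case: b => /=.
  under eq_bigr => i _ do rewrite exprS mulN1r mulNr valley_true.
  by rewrite sumrN IHw valley_true; case: (odd _) => /=; ring.
(* After a leading ascent the prefixes must be increasing throughout, which leaves the sum of
   [sum_incr_valley]. *)
under eq_bigr => i _ do rewrite exprS mulN1r mulNr valley_false.
by rewrite sumrN sum_incr_valley valley_false; case: (odd _) => /=; ring.
Qed.

End ValleyWords.

(** * The peak space is spanned by the [Xit q] with [q] odd *)

Section PeakSpace.
Variables (K : fieldType) (char0 : [pchar K] =i pred0).
Variable star : KS K -> KS K -> KS K.
Hypothesis Hstar : is_outer_D star.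

Lemma natr_neq0 n : (0 < n)%N -> n%:R != 0 :> K.
Proof. by have [/(_ char0)-> _] := pcharf0P K; rewrite lt0n. Qed.

Lemma pkw_valley n w : size w = n.-1 -> (pkw n w == set0) = valley w.
Proof.
move=> size_w; apply/eqP/(sortedP false) => [/setP pk0 i lt_i|H].
  rewrite size_w ltn_predRL in lt_i; apply/implyP => wi1; apply/negPn/negP => wi.
  by have := pk0 (Ordinal lt_i); rewrite !inE /= wi wi1.
apply/setP => -[[|[|i]] lt_i]; rewrite !inE //=; apply/negbTE/negP => /andP[wi wi1].
have := H i; rewrite size_w ltn_predRL => /(_ lt_i); rewrite wi1 /= => wi'.
by rewrite wi' in wi.
Qed.

Lemma Xit1_W n : Xit1 K n = W n (theta1 K n).
Proof.
case: n => [|n] /=; first by rewrite Xi_W.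
rewrite Pi_W -WZ; apply: W_ext => w size_w.
by rewrite pkw_valley.
Qed.

Lemma Xit_W q : Xit star q = W (sumn q) (theta K q).
Proof.
elim: q => [|x q IHq]; first by rewrite /Xit /= Xi_W.
by rewrite /Xit /= -/(Xit star q) IHq Xit1_W (star_W Hstar).
Qed.

Lemma theta_cat q r w : posword q ->
  theta K (q ++ r) w = theta K q (take (sumn q).-1 w) * theta K r (drop (sumn q) w).
Proof.
elim: q w => [|x q IHq] w /=; first by rewrite drop0 mul1r.
case/andP=> x_gt0 pos_q; rewrite IHq // drop_drop mulrA [(sumn q + x)%N]addnC.
rewrite -take_min (_ : minn _ _ = x.-1); last by lia.
case: q pos_q {IHq} => [|y q]; first by rewrite /= !mulr1.
rewrite [posword _]/= [sumn _]/= => /andP[y_gt0 _]; rewrite take_drop.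
by rewrite (_ : (y + sumn q).-1 + x = (x + (y + sumn q)).-1)%N //; lia.
Qed.

Lemma Xit_cat q r : posword q -> star (Xit star q) (Xit star r) = Xit star (q ++ r).
Proof.
move=> pos_q; rewrite !Xit_W (star_W Hstar) sumn_cat.
by apply: W_ext => w _; rewrite theta_cat.
Qed.

(** With D the set of proper partial sums of [wcomp v], the bit at [i.-1] says that i lies in D and
    the bit at [i.-2] that i - 1 does. A peak at i is interior to a block when both fail. *)
Lemma Xit_peaks v : Xit star (wcomp v) =
  2 ^+ size (wcomp v) *: \sum_(P : {set 'I_(size v).+1} |
     [forall i in P, nth false v i.-2 || nth false v i.-1]) Pi K P.
Proof.
rewrite Xit_W sumn_wcomp; under eq_bigr => P _ do rewrite Pi_W.
rewrite -W_sum -WZ; apply: W_ext => w size_w; rewrite theta_wcomp //.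
congr (_ * _); pose c (P : {set 'I_(size v).+1}) :=
  [forall i in P, nth false v i.-2 || nth false v i.-1].
have -> : peaks_in v w = c (pkw _ w).
  apply/(peaks_inP size_w)/forall_inP => [H [[|[|i]] lt_i]|H j wj wj1].
  - by rewrite inE.
  - by rewrite inE.
  - by rewrite inE /= => /andP[wi wi1]; apply: H.
  have lt_j : (j.+2 < (size v).+1)%N.
    rewrite !ltnS ltnNge; apply: contraL wj1 => le.
    by rewrite nth_default // size_w.
  by have := H (Ordinal lt_j); rewrite !inE /= wj wj1; apply.
have [cP|ncP] := boolP (c (pkw _ w)).
  rewrite (bigD1 (pkw _ w)) //= eqxx big1 ?addr0 // => P /andP[_].
  by rewrite eq_sym => /negPf->.
by rewrite big1 // => P cP; case: eqP cP ncP => // ->; rewrite /c => ->.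
Qed.

Lemma Pn_subspace n : subspace (@Pn K n). Proof. exact: lspan_subspace. Qed.

Lemma Pall_subspace : subspace (@Pall K).
Proof. exact/dsum_subspace/Pn_subspace. Qed.

Lemma Pn_Xit n q : composition n q -> Pn n (Xit star q).
Proof.
case/andP=> pos_q /eqP<-{n}; have [->|q_n0] := eqVneq q [::].
  apply: lspan_gen; exists set0; rewrite Xit_W Pi_W; apply: W_ext => w /size0nil->.
  by rewrite /= (_ : _ == _) //; apply/eqP/setP => -[].
have [v <-] := wcomp_surj pos_q q_n0; rewrite sumn_wcomp Xit_peaks.
apply: subspaceZ; first exact: Pn_subspace.
apply: subspace_sum => [|P _]; first exact: Pn_subspace.
by apply: lspan_gen; exists P.
Qed.

(** The common part cancels and [h] moves the rest of [A] to heavier elements of [B]. If [A] has no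
    rest, positivity of [f] on the rest of [B] decides. *)
Lemma sum_lt_card (T : finType) (A B : {set T}) (f : T -> nat) (h : T -> T) :
  (forall i, i \in A :\: B -> [/\ h i \in B :\: A & (f i < f (h i))%N]) ->
  {in A :\: B &, injective h} -> (forall i, 0 < f i)%N -> A != B ->
  (\sum_(i in A) f i < \sum_(i in B) f i)%N.
Proof.
move=> hAB hinj f_gt0 nAB.
rewrite (big_setID B) [X in (_ < X)%N](big_setID A) /= setIC ltn_add2l.
have sub : h @: (A :\: B) \subset B :\: A.
  by apply/subsetP => _ /imsetP[i iA ->]; case: (hAB i iA).
rewrite [X in (_ < X)%N](big_setID (h @: (A :\: B))) /= (setIidPr sub) big_imset //=.
have [A0|[i iA]] := set_0Vmem (A :\: B).
  rewrite A0 !big_set0 add0n imset0 setD0.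
  have [B0|[j jB]] := set_0Vmem (B :\: A).
    by case/eqP: nAB; apply/eqP; rewrite eqEsubset -!setD_eq0 A0 B0 !eqxx.
  by rewrite (bigD1 j) //= (leq_trans (f_gt0 j)) // leq_addr.
rewrite (leq_trans _ (leq_addr _ _)) //.
rewrite (bigD1 i) //= [X in (_ < X)%N](bigD1 i) //= -addSn leq_add //.
  by case: (hAB i iA).
by apply: leq_sum => j /andP[jA _]; case: (hAB j jA) => _ /ltnW.
Qed.

(* The pattern of [P - 1], so that [Xit (wcomp v)] collects the peak sets
   contained in [P :|: (P - 1)]; all but [P] have smaller sum. *)
Lemma Pi_span_Xit n (P : {set 'I_n}) :
  lspan (fun x => exists2 q, composition n q & x = Xit star q) (Pi K P).
Proof.
have sS := lspan_subspace (fun x => exists2 q, composition n q & x = Xit star q).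
case: n P sS => [|m] P sS.
  apply: lspan_gen; exists [::] => //; rewrite Xit_W Pi_W.
  by apply: W_ext => w /size0nil->; rewrite (_ : _ == _) //; apply/eqP/setP => -[].
(* The weight [i.+1] instead of [i] is positive, as [sum_lt_card] requires. *)
have [k] := ubnP (\sum_(i in P) i.+1); elim: k P => // k IHk P le_k.
pose v := mkseq (fun j => [exists i in P, i == j.+2 :> nat]) m.
have size_v : size v = m by rewrite size_mkseq.
have vE j : nth false v j = [exists i in P, i == j.+2 :> nat].
  have [lt_j|le_j] := ltnP j m; first by rewrite nth_mkseq.
  rewrite nth_default ?size_v //; apply/esym/negbTE/existsP => -[i /andP[_ /eqP e]].
  by have := ltn_ord i; rewrite e; lia.
have SX := Xit_peaks v; rewrite size_v in SX.
pose c (Q : {set 'I_m.+1}) := [forall i in Q, nth false v i.-2 || nth false v i.-1].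
(* An index of [Q] outside [P] has its successor in [P]; this successor is not in [Q], since two
   neighbours are never both peaks. So the successor map fits [sum_lt_card]. *)
have small (Q : {set 'I_m.+1}) w : c Q -> Q != P -> pkw m.+1 w = Q ->
    (\sum_(i in Q) i.+1 < \sum_(i in P) i.+1)%N.
  move=> /forall_inP cQ nQP pkQ.
  have geQ (i : 'I_m.+1) : i \in Q -> (1 < i)%N by rewrite -pkQ inE => /andP[].
  have sucQ (i : 'I_m.+1) : i \in Q :\: P -> exists2 j : 'I_m.+1, j \in P & j = i.+1 :> nat.
    rewrite inE => /andP[iP iQ]; have i1 := geQ i iQ.
    have := cQ i iQ; rewrite !vE => /orP[] /exists_inP[j jP /eqP e].
      by case/negP: iP; rewrite (_ : i = j) //; apply: val_inj; rewrite /= e; lia.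
    by exists j; rewrite // e; lia.
  pose h (i : 'I_m.+1) := odflt i [pick j in P | j == i.+1 :> nat].
  have hP i : i \in Q :\: P -> h i \in P /\ h i = i.+1 :> nat.
    move=> /sucQ[j jP e]; rewrite /h; case: pickP => [l /andP[lP /eqP]|] //=.
    by move/(_ j); rewrite jP e eqxx.
  apply: (@sum_lt_card _ _ _ _ h) => // [i iQP|i j iQ jQ e].
    have [hi ei] := hP i iQP; split; last by rewrite ei.
    rewrite inE hi andbT -pkQ inE ei.
    have : i \in Q by case/setDP: iQP.
    rewrite -pkQ inE => /and3P[i2 _ wi1]; apply/negP => /and3P[_].
    by rewrite [X in nth _ _ X](_ : _ = i.-1) ?wi1 //.
  have [[_ ei] [_ ej]] := (hP i iQ, hP j jQ); apply: val_inj.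
  by have := congr1 val e; rewrite /= ei ej => -[].
(* [small] applies only to sets that are peak sets of some word; the other [Pi K Q] vanish. *)
have Pi0 (Q : {set 'I_m.+1}) : (forall w, size w = m -> pkw m.+1 w != Q) -> Pi K Q = 0.
  move=> nQ; rewrite Pi_W -(W0 K m.+1); apply: W_ext => w size_w.
  by rewrite (negPf (nQ w size_w)).
have real (Q : {set 'I_m.+1}) : Pi K Q = 0 \/ exists2 w, size w = m & pkw m.+1 w = Q.
  have [/existsP[w /eqP Qw]|/existsPn nQ] :=
    boolP [exists w : m.-tuple bool, pkw m.+1 w == Q].
    by right; exists w; rewrite ?size_tuple.
  by left; apply: Pi0 => w /eqP size_w; apply: (nQ (Tuple size_w)).
have [->|[w _ Pw]] := real P; first by case: sS.
have cP : c P.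
  apply/forall_inP => i iP; rewrite !vE; apply/orP; left.
  apply/existsP; exists i; rewrite iP; move: iP; rewrite -Pw inE => /and3P[i2 _ _].
  by apply/eqP; lia.
have -> : Pi K P = (2 ^+ size (wcomp v))^-1 *: Xit star (wcomp v)
                   - \sum_(Q | c Q && (Q != P)) Pi K Q.
  rewrite SX scalerA mulVf ?expf_neq0 ?natr_neq0 // scale1r.
  by rewrite [X in X - _](bigD1 P) //= addrK.
apply: subspaceB => //; first apply: subspaceZ => //.
  by apply: lspan_gen; exists (wcomp v); rewrite // /composition wcomp_pos sumn_wcomp size_v eqxx.
apply: subspace_sum => // Q /andP[cQ nQP].
have [->|[u _ Qu]] := real Q; first by case: sS.
by apply: IHk; rewrite -ltnS (leq_trans _ le_k) // ltnS (small Q u).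
Qed.

(** In even degree both extreme terms of [Xit(-t) Xit(t)] equal [Xit1 n], whence the factor 1/2; in
    odd degree they would cancel. *)
Lemma Xit1_even n : ~~ odd n -> (0 < n)%N ->
  Xit1 K n = 2^-1 *:
    \sum_(j < n.-1) (-1) ^+ j *: star (Xit1 K j.+1) (Xit1 K (n - j.+1)%N).
Proof.
case: n => // m odd_m _; rewrite /= negbK in odd_m.
have -> : \sum_(j < m) (-1) ^+ j *: star (Xit1 K j.+1) (Xit1 K (m.+1 - j.+1)%N) =
  W m.+1 (fun w => 4 * \sum_(j < m)
    (-1) ^+ j * ((valley (take j w))%:R * (valley (drop j.+1 w))%:R)).
  rewrite WZ W_sum scaler_sumr; apply: eq_bigr => j _.
  rewrite !Xit1_W (star_W Hstar) -!WZ subnKC 1?ltnW ?ltnS //.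
  apply: W_ext => w _; rewrite subSS -(@prednK (m - j)) ?subn_gt0 //=.
  by ring.
rewrite -WZ Xit1_W; apply: W_ext => w size_w.
have -> : m = size w by rewrite size_w.
rewrite sum_valley_valley size_w /= odd_m mul1r mulrA.
by congr (_ * _); rewrite (natrM K 2 2) mulKf ?natr_neq0.
Qed.

Lemma odd_composition_comp n q : odd_composition n q -> composition n q.
Proof.
case/andP=> odd_q sum_q; rewrite /composition sum_q andbT.
by apply: sub_all odd_q => -[].
Qed.

Lemma odd_composition_cat n m q r :
  odd_composition n q -> odd_composition m r -> odd_composition (n + m) (q ++ r).
Proof.
move=> /andP[oq /eqP sq] /andP[or /eqP sr].
by rewrite /odd_composition /oddword all_cat sumn_cat sq sr eqxx andbT; apply/andP.
Qed.

Definition oddXit n x := exists2 q, odd_composition n q & x = Xit star q.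

Lemma Dall_Xit q : Dall (Xit star q).
Proof. by rewrite Xit_W; apply: Dall_W. Qed.

Lemma oddXit_star n m x y :
  lspan (oddXit n) x -> lspan (oddXit m) y -> lspan (oddXit (n + m)) (star x y).
Proof.
have [bil _] := Hstar.
apply: (bilinear_on_lspan (@Dall_subspace K) bil (lspan_subspace _)).
- by move=> _ [q _ ->]; apply: Dall_Xit.
- by move=> _ [q _ ->]; apply: Dall_Xit.
move=> _ _ [q oq ->] [r or ->]; apply: lspan_gen; exists (q ++ r).
  exact: odd_composition_cat.
by rewrite Xit_cat //; case/andP: (odd_composition_comp oq).
Qed.

Lemma Xit_seq1 n : Xit star [:: n] = Xit1 K n.
Proof.
rewrite Xit_W Xit1_W /= addn0; apply: W_ext => w size_w.
by rewrite mulr1 -size_w take_size.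
Qed.

Lemma Xit1_odd n : lspan (oddXit n) (Xit1 K n).
Proof.
have [m] := ubnP n; elim: m n => // m IHm [|n] le_n.
  by apply: lspan_gen; exists [::].
have [odd_n|even_n] := boolP (odd n.+1).
  apply: lspan_gen; exists [:: n.+1]; last by rewrite Xit_seq1.
  by rewrite /odd_composition /oddword /= in odd_n *; rewrite odd_n addn0 eqxx.
rewrite Xit1_even //; apply: subspaceZ; first exact: lspan_subspace.
apply: subspace_sum => [|[j /= lt_j] _]; first exact: lspan_subspace.
apply: subspaceZ; first exact: lspan_subspace.
rewrite -[X in oddXit X](subnKC (leqW lt_j)).
by apply: oddXit_star; apply: IHm; lia.
Qed.

Lemma Xit_odd n q : sumn q = n -> lspan (oddXit n) (Xit star q).
Proof.
elim: q n => [|x q IHq] n <- /=; first by apply: lspan_gen; exists [::].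
by apply: oddXit_star; [exact: Xit1_odd | exact: IHq].
Qed.

Lemma PnP n x : Pn n x <-> lspan (oddXit n) x.
Proof.
split; last first.
  by apply: lspan_mono => _ [q /odd_composition_comp oq ->]; apply: Pn_Xit.
apply: lspan_mono => _ [P ->]; apply: lspan_mono (Pi_span_Xit P) => _ [q /andP[_ /eqP sq] ->].
exact: Xit_odd.
Qed.

Lemma PallP x : Pall x <-> lspan (fun y => exists2 q, oddword q & y = Xit star q) x.
Proof.
split.
  apply: dsum_min => [|n y /PnP]; first exact: lspan_subspace.
  by apply: lspan_mono => _ [q /andP[oq _] ->]; apply: lspan_gen; exists q.
apply: lspan_min; first exact: Pall_subspace.
move=> _ [q oq ->]; apply: (dsum_gen (n := sumn q)); first exact: Pn_subspace.
by apply: Pn_Xit; apply: odd_composition_comp; apply/andP.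
Qed.

Lemma Pall_Dall (x : KS K) : Pall x -> Dall x.
Proof.
move/PallP; apply: (lspan_min (@Dall_subspace K)) => _ [q _ ->].
exact: Dall_Xit.
Qed.

Lemma Pall_star x y : Pall x -> Pall y -> Pall (star x y).
Proof.
have [bil _] := Hstar; move=> /PallP Gx /PallP Gy.
apply: (bilinear_on_lspan (@Dall_subspace K) bil Pall_subspace _ _ _ Gx Gy).
- by move=> _ [q _ ->]; apply: Dall_Xit.
- by move=> _ [q _ ->]; apply: Dall_Xit.
move=> _ _ [q oq ->] [r or ->]; apply/PallP; apply: lspan_gen; exists (q ++ r).
  by rewrite /oddword all_cat; apply/andP.
by rewrite Xit_cat //; apply: sub_all oq => -[].
Qed.

End PeakSpace.

(** * Sums over labellings of positions *)

Section Labelings.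
Variable K : fieldType.

(** The recursion makes the sum split along concatenations. The equivalent sum over finite functions
    ([wsum_ffun]) is the one that can be reindexed by a permutation. *)
Fixpoint wsum l n (F : seq nat -> K) : K :=
  if n is n'.+1 then \sum_(i < l) wsum l n' (fun g => F ((i : nat) :: g))
  else F [::].

Lemma eq_wsum l n F G :
  (forall g, size g = n -> all (gtn l) g -> F g = G g) -> wsum l n F = wsum l n G.
Proof.
elim: n F G => [|n IHn] F G eFG /=; first exact: eFG.
apply: eq_bigr => i _; apply: IHn => g sg ag; apply: eFG; first by rewrite /= sg.
by rewrite /= ltn_ord.
Qed.

Lemma wsum_cat l n m F :
  wsum l (n + m) F = wsum l n (fun g => wsum l m (fun h => F (g ++ h))).
Proof. by elim: n F => //= n IHn F; apply: eq_bigr => i _; rewrite IHn. Qed.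

Lemma wsum_mull l n a F : wsum l n (fun g => a * F g) = a * wsum l n F.
Proof.
by elim: n F => //= n IHn F; rewrite mulr_sumr; apply: eq_bigr => i _; apply: IHn.
Qed.

Lemma wsum_sum l n (I : Type) (r : seq I) (F : I -> seq nat -> K) :
  wsum l n (fun g => \sum_(i <- r) F i g) = \sum_(i <- r) wsum l n (F i).
Proof.
elim: n F => //= n IHn F; rewrite exchange_big /=; apply: eq_bigr => i _.
exact: IHn.
Qed.

Definition word_of n l (g : {ffun 'I_n -> 'I_l}) : seq nat :=
  [seq (g i : nat) | i <- enum 'I_n].

Lemma size_word_of n l (g : {ffun 'I_n -> 'I_l}) : size (word_of g) = n.
Proof. by rewrite size_map size_enum_ord. Qed.

Lemma nth_word_of n l (g : {ffun 'I_n -> 'I_l}) (i : 'I_n) :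
  nth 0%N (word_of g) i = g i.
Proof. by rewrite (nth_map i) ?size_enum_ord // nth_ord_enum. Qed.

Lemma wsum_ffun l n F :
  wsum l n F = \sum_(g : {ffun 'I_n -> 'I_l}) F (word_of g).
Proof.
transitivity (\sum_(t : n.-tuple 'I_l) F (map (@nat_of_ord l) t)).
  elim: n F => [|n IHn] F /=.
    rewrite (bigD1 [tuple]) //= big1 ?addr0 // => t /negP[].
    exact/eqP/tuple0.
  rewrite (reindex (fun p : 'I_l * n.-tuple 'I_l => [tuple of p.1 :: p.2])) /=.
    rewrite (eq_bigr _ (fun i _ => IHn _)) pair_bigA /=.
    by apply: eq_bigr => -[i t].
  exists (fun t => (thead t, [tuple of behead t])) => [[i t] _|t _] /=.
    by congr (_, _); apply: val_inj.
  by rewrite -tuple_eta.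
rewrite (reindex (fun g : {ffun 'I_n -> 'I_l} => [tuple g i | i < n])) /=.
  by apply: eq_bigr => g _; rewrite /word_of -map_comp.
exists (fun t => [ffun i => tnth t i]) => [g _|t _].
  by apply/ffunP => i; rewrite ffunE tnth_mktuple.
by apply: eq_from_tnth => i; rewrite tnth_mktuple ffunE.
Qed.

End Labelings.

(** * The permutation that ranks an injective key *)

Section SortingPermutation.
Variable n : nat.

Lemma card_lt_perm (s : 'S_n) i : #|[set j | (s j < s i)%N]| = s i.
Proof.
rewrite -(card_imset _ (@perm_inj _ s)).
have -> : s @: [set j | (s j < s i)%N] = [set k : 'I_n | (k < s i)%N].
  apply/setP => k; apply/imsetP/idP => [[j]|]; first by rewrite inE => ? ->; rewrite inE.
  by rewrite inE => lt_k; exists (s^-1%g k); rewrite ?inE permKV.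
rewrite cardsE -sum1_card /= -(big_ord_widen n (fun=> 1%N)) ?sum1_card ?card_ord //.
exact: ltnW.
Qed.

Lemma sort_perm (key : 'I_n -> nat) : injective key ->
  exists s : 'S_n, forall i j, (key i < key j)%N = (s i < s j)%N.
Proof.
move=> key_inj; pose rk i := #|[set j | (key j < key i)%N]|.
have rk_lt i : (rk i < n)%N.
  rewrite -[X in (_ < X)%N]card_ord; apply: proper_card; apply/properP.
  by split; [exact/subsetP | exists i; rewrite ?inE ?ltnn].
have rk_mono i j : (key i < key j)%N -> (rk i < rk j)%N.
  move=> lt_ij; apply: proper_card; apply/properP; split.
    by apply/subsetP => k; rewrite !inE => /ltn_trans; apply.
  by exists i; rewrite !inE ?ltnn.
have rkE i j : (rk i < rk j)%N = (key i < key j)%N.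
  apply/idP/idP => [|/rk_mono//]; apply: contraTT; rewrite -!leqNgt leq_eqVlt.
  by case/orP=> [/eqP/key_inj->//|/rk_mono/ltnW].
have rk_inj : injective (fun i => Ordinal (rk_lt i)).
  move=> i j /(congr1 val) e; have {}e : rk i = rk j := e.
  apply: key_inj; apply/eqP; have := rkE i j; have := rkE j i.
  by rewrite e ltnn; case: ltngtP.
by exists (perm rk_inj) => i j; rewrite !permE /= rkE.
Qed.

Lemma sort_perm_uniq (key : 'I_n -> nat) (s t : 'S_n) :
  (forall i j, (key i < key j)%N = (s i < s j)%N) ->
  (forall i j, (key i < key j)%N = (t i < t j)%N) -> s = t.
Proof.
move=> ks kt; apply/permP => i; apply: val_inj; rewrite /= -(card_lt_perm s) -(card_lt_perm t).
by apply: eq_card => j; rewrite !inE -ks kt.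
Qed.

Lemma key_mono (key : 'I_n -> nat) :
  (forall i j : 'I_n, j = i.+1 :> nat -> (key i < key j)%N) ->
  forall i j : 'I_n, (key i < key j)%N = (i < j)%N.
Proof.
move=> step.
have mono (i j : 'I_n) : (i < j)%N -> (key i < key j)%N.
  case: j => j lt_j /=; elim: j lt_j => // j IHj lt_j.
  rewrite ltnS leq_eqVlt => /orP[/eqP e|lt_i]; first by apply: step; rewrite /= e.
  apply: ltn_trans (IHj (ltnW lt_j) lt_i) _.
  exact: (step (Ordinal (ltnW lt_j)) (Ordinal lt_j)).
move=> i j; apply/idP/idP => [|/mono//]; apply: contraTT; rewrite -!leqNgt.
by rewrite leq_eqVlt => /orP[/eqP/val_inj->//|/mono/ltnW].
Qed.

End SortingPermutation.

(** * Standardisation of labelled words and inner products with [Xi q] *)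

Section CompatibleWords.
Variable eps : nat -> bool.

(* Letters [i], [j] may follow each other over a descent bit [b] when [i < j],
   or when [i = j] and [b] is the direction that [eps] prescribes for [i]. *)
Definition cstep i j b : bool := (i < j)%N || ((i == j) && (b == eps i)).

(** The descent word of the standardisation of the pairs (label, value), see [dword_cword]. The
    point is that it depends on the values only through their descent word [w]. *)
Fixpoint cword (w : bitseq) (g : seq nat) : bitseq :=
  match g, w with
  | i :: ((j :: _) as g'), b :: w' => ~~ cstep i j b :: cword w' g'
  | _, _ => [::]
  end.

Lemma size_cword w g : size (cword w g) = minn (size w) (size g).-1.
Proof.
by elim: w g => [|b w IHw] [|i [|j g]] //=; rewrite ?IHw ?minn0 ?min0n ?minnSS.
Qed.

Lemma nth_cword w g j : size g = (size w).+1 -> (j < size w)%N ->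
  nth false (cword w g) j = ~~ cstep (nth 0%N g j) (nth 0%N g j.+1) (nth false w j).
Proof.
elim: w g j => // b w IHw [|i [|k g]] [|j] //= [sg] lt_j.
by rewrite IHw //= sg.
Qed.

Lemma take_cword k w g : take k (cword w g) = cword (take k w) (take k.+1 g).
Proof.
elim: k w g => [|k IHk] [|b w] [|i [|j g]] //=; rewrite ?take0 //.
by rewrite IHk.
Qed.

Lemma drop_cword k w g : drop k (cword w g) = cword (drop k w) (drop k g).
Proof.
elim: k w g => [|k IHk] [|b w] [|i [|j g]] //=; rewrite ?drop0 //.
all: by rewrite ?IHk //; case: (drop _ _) => // ? [].
Qed.

Lemma inclb_cword_cat x w g h q : (0 < x)%N -> size g = x ->
  inclb (cword w (g ++ h)) (x :: q) =
  all negb (cword (take x.-1 w) g) && inclb (cword (drop x w) h) q.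
Proof.
move=> x_gt0 sg /=; rewrite take_cword drop_cword prednK //.
by rewrite take_size_cat ?drop_size_cat.
Qed.

Section Count.
Variable n : nat.

(** Reversing the values under a label with [eps a] makes its prescribed descents increase the key.
    Since offsets stay below [n], the factor [n] in [key] makes the comparison lexicographic. *)
Let offset a (v : 'I_n) : nat := if eps a then rev_ord v else v.

Let key l (g : {ffun 'I_n -> 'I_l}) (t : 'S_n) (i : 'I_n) : nat :=
  (g i * n + offset (g i) (t i))%N.

Let offset_lt a v : (offset a v < n)%N. Proof. by rewrite /offset; case: ifP. Qed.

Let key_lt l (g : {ffun 'I_n -> 'I_l}) t i j : i != j ->
  (key g t i < key g t j)%N = cstep (g i) (g j) (t j < t i)%N.
Proof.
move=> ij; rewrite /cstep /key.
have ti := offset_lt (g i) (t i); have tj := offset_lt (g j) (t j).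
have tij : t i != t j by rewrite (inj_eq perm_inj).
have [lt_g|lt_g|eq_g] := ltngtP (g i) (g j); last first.
- rewrite eq_g ltn_add2l /offset; have ti' := ltn_ord (t i); have tj' := ltn_ord (t j).
  rewrite -(inj_eq val_inj) /= in tij.
  by case: (eps _) => /=; case: (ltngtP (t j) (t i)) tij => //= ? _; lia.
- by apply/negbTE; rewrite -leqNgt; nia.
by nia.
Qed.

Let key_inj l (g : {ffun 'I_n -> 'I_l}) t : injective (key g t).
Proof.
move=> i j e; apply/eqP; apply: contraT => ij.
have := key_lt g t ij; have := key_lt g t (i := j) (j := i); rewrite eq_sym => /(_ ij).
rewrite e ltnn /cstep; case: ltngtP => //= -> .
have tij : t i != t j by rewrite (inj_eq perm_inj).
rewrite -(inj_eq val_inj) /= in tij.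
by case: ltngtP tij => //= _ _; case: (eps _).
Qed.

Let nth_cword_key l (g : {ffun 'I_n -> 'I_l}) t (i j : 'I_n) : j = i.+1 :> nat ->
  nth false (cword (dword t) (word_of g)) i = ~~ (key g t i < key g t j)%N.
Proof.
move=> ji; have n_gt0 : (0 < n)%N by apply: leq_trans (ltn_ord i).
have ij : i != j by rewrite -(inj_eq val_inj) /= ji ltn_eqF.
have lt_i : (i < n.-1)%N by rewrite ltn_predRL -ji.
rewrite nth_cword ?size_word_of ?size_dword ?prednK //.
by rewrite nth_word_of -ji nth_word_of (nth_dword_ord _ ji) key_lt.
Qed.

Let size_cword_dword l (g : {ffun 'I_n -> 'I_l}) (t : 'S_n) :
  size (cword (dword t) (word_of g)) = n.-1.
Proof. by rewrite size_cword size_word_of size_dword minnn. Qed.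

Let ord_succ k : (k < n.-1)%N -> exists i j : 'I_n, i = k :> nat /\ j = k.+1 :> nat.
Proof.
by rewrite ltn_predRL => lt_k; exists (Ordinal (ltnW lt_k)), (Ordinal lt_k).
Qed.

Let all_cword l (g : {ffun 'I_n -> 'I_l}) (t : 'S_n) :
  all negb (cword (dword t) (word_of g)) =
  [forall i, forall j, (key g t i < key g t j)%N == (i < j)%N].
Proof.
apply/(all_nthP false)/forallP => [H i|H k].
  apply/forallP => j; apply/eqP; apply: key_mono => {}i {}j ji.
  rewrite -[(_ < _)%N]negbK -(nth_cword_key _ _ ji) H // size_cword_dword.
  by rewrite ltn_predRL -ji.
rewrite size_cword_dword => /ord_succ[i [j [<- ej]]].
have /forallP/(_ j)/eqP := H i.
by rewrite (nth_cword_key _ _ ej) negbK ej ltnSn.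
Qed.

Lemma dword_cword l (g : {ffun 'I_n -> 'I_l}) (t s : 'S_n) :
  (forall i j, (key g t i < key g t j)%N = (s i < s j)%N) ->
  dword s = cword (dword t) (word_of g).
Proof.
move=> keys; apply: (@eq_from_nth _ false); first by rewrite size_dword size_cword_dword.
move=> k; rewrite size_dword => /ord_succ[i [j [<- ej]]].
rewrite (nth_dword_ord _ ej) (nth_cword_key _ _ ej) keys -leqNgt [RHS]leq_eqVlt.
case: eqP => // e; move: ej; rewrite (perm_inj (val_inj e)) => ej.
by have := n_Sn i; rewrite -ej.
Qed.

Variable K : fieldType.

(* Standardising [(g i, t i)] replaces a pair (s, g') with [g = g' \o s] by the
   single labelling [g]; [s] is then the rank of [(g i, t i)]. *)
Lemma count_products l (C : seq nat -> K) q (t : 'S_n) :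
  (forall g h, perm_eq g h -> C g = C h) ->
  \sum_(s : 'S_n) (inclb (dword s) q)%:R *
     wsum l n (fun g => C g * (all negb (cword (dword (s^-1 * t)%g) g))%:R) =
  wsum l n (fun g => C g * (inclb (cword (dword t) g) q)%:R).
Proof.
move=> Cperm; pose sorts (s : 'S_n) (g : {ffun 'I_n -> 'I_l}) :=
  [forall i, forall j, (key g t i < key g t j)%N == (s i < s j)%N].
have sortsP (s : 'S_n) (g : {ffun 'I_n -> 'I_l}) : reflect (forall i j, (key g t i < key g t j)%N = (s i < s j)%N) (sorts s g).
  apply: (iffP forallP) => H i; first by move=> j; have /forallP/(_ j)/eqP := H i.
  by apply/forallP => j; rewrite H.
transitivity (\sum_(s : 'S_n) \sum_(g : {ffun 'I_n -> 'I_l})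
    (inclb (dword s) q)%:R * (C (word_of g) * (sorts s g)%:R)).
  apply: eq_bigr => s _; rewrite wsum_ffun mulr_sumr.
  (* With [g] composed with the inverse of [s], compatibility with [s^-1 * t] says that [s] ranks
     [key g t], which singles out one [s] for each [g]. The value of [C] is unchanged, as only the
     order of the labels changes. *)
  rewrite (reindex (fun g : {ffun 'I_n -> 'I_l} => [ffun i => g (s^-1%g i)])) /=; last first.
    exists (fun g : {ffun 'I_n -> 'I_l} => [ffun i => g (s i)]) => g _;
      by apply/ffunP => i; rewrite !ffunE ?permK ?permKV.
  apply: eq_bigr => g _; congr (_ * (_ * (_ : bool)%:R)).
    apply: Cperm; rewrite /word_of (map_comp (@nat_of_ord l)) [X in perm_eq _ X](map_comp (@nat_of_ord l)).
    apply: perm_map; rewrite (eq_map (g := g \o (s^-1)%g)) => [|i]; last by rewrite ffunE.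
    rewrite map_comp; apply: perm_map; apply: uniq_perm; rewrite ?enum_uniq //.
      by rewrite map_inj_uniq ?enum_uniq //; apply: perm_inj.
    move=> i; rewrite mem_enum; apply/mapP.
    by exists (s i); rewrite ?mem_enum ?permK.
  rewrite all_cword; apply/forallP/sortsP => H i.
    move=> j; have /forallP/(_ (s j))/eqP <- := H (s i).
    by rewrite /key !ffunE !permM !permK.
  apply/forallP => j; rewrite -{2}(permKV s i) -{2}(permKV s j) -H.
  by rewrite /key !ffunE !permM.
rewrite wsum_ffun exchange_big /=; apply: eq_bigr => g _.
have [s ss] := sort_perm (@key_inj l g t).
rewrite (bigD1 s) //= big1 => [|r rs]; last first.
  case: sortsP => [rr|_]; last by rewrite !mulr0.
  by case/eqP: rs; apply: sort_perm_uniq rr ss.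
by rewrite (introT (sortsP _ _) ss) (dword_cword ss) addr0 mulr1 mulrC.
Qed.

End Count.
End CompatibleWords.

(** * Inner products of [Xi q] with [Xit1 n] and with [Xi r] *)

Section InnerProductOfWords.
Variable K : fieldType.

Lemma inner_W n (f h : bitseq -> K) :
  inner_perm (W n f) (W n h) =
  fun_elt (fun t : 'S_n => \sum_s f (dword s) * h (dword (s^-1 * t)%g)).
Proof. exact: inner_perm_fun_elt. Qed.

Definition valley_dir (i : nat) : bool := i == 0%N.

Lemma wsum0 l n : wsum l n (fun=> 0) = 0 :> K.
Proof. by elim: n => //= n IHn; rewrite big1. Qed.

Lemma cword_valley_dir1 u n : size u = n ->
  wsum 2 n (fun g => (all negb (cword valley_dir u (1%N :: g)))%:R) = (all negb u)%:R :> K.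
Proof.
elim: n u => [|n IHn] [|b u] //= [su]; rewrite !big_ord_recl big_ord0 /= addr0.
rewrite wsum0 add0r /cstep /valley_dir /= negbK eqbF_neg.
by case: b; rewrite /= ?wsum0 ?IHn.
Qed.

(** A valley word has two labellings, since its lowest letter may take either label. The one
    beginning with label 1 exists only if the word increases throughout, and is subtracted. *)
Lemma cword_valley_dir0 u n : size u = n ->
  wsum 2 n (fun g => (all negb (cword valley_dir u (0%N :: g)))%:R) =
  2 * (valley u)%:R - (all negb u)%:R :> K.
Proof.
elim: n u => [|n IHn] [|b u] //=.
  by move=> _; rewrite /valley /= mulr1 -[2]/(1 + 1) addrK.
case=> su; rewrite !big_ord_recl big_ord0 /= addr0 /cstep /valley_dir /= !negbK.
rewrite (cword_valley_dir1 su); case: b; rewrite /= ?wsum0 ?IHn //.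
  by rewrite valley_true subrK subr0.
by rewrite valley_false; ring.
Qed.

Lemma cword_valley_dir u n : size u = n.-1 ->
  wsum 2 n (fun g => (all negb (cword valley_dir u g))%:R) = theta1 K n u.
Proof.
case: n => [|n] /= su; first by rewrite (size0nil su).
rewrite !big_ord_recl big_ord0 /= addr0.
by rewrite cword_valley_dir0 // cword_valley_dir1 // subrK.
Qed.

Lemma wsum_cword_theta q w : posword q -> size w = (sumn q).-1 ->
  wsum 2 (sumn q) (fun g => (inclb (cword valley_dir w g) q)%:R) = theta K q w.
Proof.
elim: q w => // x q IHq w /= /andP[x_gt0 pos_q] sw; rewrite wsum_cat.
rewrite -(IHq (drop x w)) //; last by rewrite size_drop sw; lia.
rewrite -(cword_valley_dir (n := x)); last by rewrite size_take_min sw; lia.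
rewrite mulrC -wsum_mull; apply: eq_wsum => g sg _.
rewrite mulrC -wsum_mull; apply: eq_wsum => h sh _.
by rewrite -[_ && _]/(inclb _ (x :: q)) inclb_cword_cat // -mulnb natrM.
Qed.

Lemma Xi_inner_Xit1 n q (star : KS K -> KS K -> KS K) :
  is_outer_D star -> composition n q ->
  inner_perm (Xi K q) (Xit1 K n) = Xit star q.
Proof.
move=> Hstar comp_q; rewrite (Xi_comp _ comp_q) Xit1_W (Xit_W Hstar) inner_W.
case/andP: comp_q => pos_q /eqP <-; apply: fun_elt_ext => t.
have := count_products valley_dir (C := fun=> 1 : K) 2 q t (fun _ _ _ => erefl).
have -> : wsum 2 (sumn q) (fun g => 1 * (inclb (cword valley_dir (dword t) g) q)%:R)
        = theta K q (dword t).
  rewrite -wsum_cword_theta ?size_dword //.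
  by apply: eq_wsum => g _ _; rewrite mul1r.
move=> <-; apply: eq_bigr => s _; congr (_ * _).
rewrite -cword_valley_dir ?size_dword //.
by apply: eq_wsum => g _ _; rewrite mul1r.
Qed.

Definition no_dir (i : nat) : bool := false.

Definition cnt l (g : seq nat) : seq nat := mkseq (fun i => count_mem i g) l.

Definition incr1 (a : seq nat) := if a is x :: a' then x.+1 :: a' else [::].

Lemma cnt_cons0 l g : cnt l.+1 (0%N :: g) = incr1 (cnt l.+1 g).
Proof.
by rewrite /cnt /mkseq /=; congr (_ :: _); rewrite (iotaDl 1 0) -!map_comp.
Qed.

Lemma cnt_succ l g : cnt l.+1 (map succn g) = 0%N :: cnt l g.
Proof.
rewrite /cnt /mkseq /=; congr (_ :: _).
  by rewrite count_map; elim: g.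
rewrite (iotaDl 1 0) -map_comp; apply: eq_map => i /=.
by rewrite count_map; apply: eq_count => j /=.
Qed.

(** The labels weakly increase, strictly over descents: when [F] is the monomial of the label
    counts, this is the fundamental quasisymmetric polynomial of [u] in [l] variables. *)
Definition Y l x (F : seq nat -> K) (u : bitseq) : K :=
  wsum l x (fun g => F (cnt l g) * (all negb (cword no_dir u g))%:R).

(** Labels weakly increase, so label 0 cannot follow [i.+1], and all labels can be lowered by
    one. *)
Lemma cword_shift l n i u (G : seq nat -> K) : size u = n ->
  wsum l.+1 n (fun g => G (i.+1 :: g) * (all negb (cword no_dir u (i.+1 :: g)))%:R) =
  wsum l n (fun g => G (map succn (i :: g)) * (all negb (cword no_dir u (i :: g)))%:R).
Proof.
elim: n u i G => [|n IHn] [|b u] i G //=; case=> su; rewrite big_ord_recl /=.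
under eq_wsum => g _ _ do rewrite mulr0.
rewrite wsum0 add0r; apply: eq_bigr => k _.
transitivity (wsum l.+1 n (fun g => G [:: i.+1, k.+1 & g] *
    (cstep no_dir i k b)%:R * (all negb (cword no_dir u (k.+1 :: g)))%:R)).
  by apply: eq_wsum => g _ _; rewrite negbK -mulnb natrM mulrA /bump /= add1n.
rewrite (IHn u k (fun g => G (i.+1 :: g) * (cstep no_dir i k b)%:R) su).
apply: eq_wsum => g _ _.
by rewrite negbK -mulrA -natrM mulnb.
Qed.

Lemma Y_first l n u F : size u = n ->
  \sum_(i < l) wsum l.+1 n (fun g => F (cnt l.+1 (i.+1 :: g)) *
     (all negb (cword no_dir u (i.+1 :: g)))%:R) = Y l n.+1 (fun b => F (0%N :: b)) u.
Proof.
move=> su; apply: eq_bigr => i _.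
rewrite (cword_shift l i (fun g => F (cnt l.+1 g)) su).
by apply: eq_wsum => g _ _; rewrite cnt_succ.
Qed.

(** Here [a] is the number of letters labelled 0. They form a prefix without descents; the bit after
    it is free, because the label increases there. *)
Lemma Y_rec l x u F : size u = x.-1 ->
  Y l.+1 x F u = \sum_(a < x.+1)
    (all negb (take a.-1 u))%:R * Y l (x - a) (fun b => F ((a : nat) :: b)) (drop a u).
Proof.
elim: x u F => [|x IHx] u F su.
  rewrite big_ord_recl big_ord0 addr0 (size0nil su) /Y /= mul1r !mulr1.
  by congr F; rewrite /cnt /mkseq /= (iotaDl 1 0) -map_comp.
rewrite [LHS]big_ord_recl [RHS]big_ord_recl /= take0 drop0 mul1r subn0 addrC.
congr (_ + _); first exact: Y_first.
case: x u su IHx => [|x] u su IHx.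
  rewrite big_ord_recl big_ord0 addr0 (size0nil su) mul1r /Y /= !mulr1.
  by congr F; rewrite cnt_cons0 /cnt /mkseq /= (iotaDl 1 0) -map_comp.
case: u su => // b u [su]; have := IHx u (fun a => F (incr1 a)) su.
(* After a leading 0, a descent forbids a second 0 and leaves only [a = 1]; over an ascent the
   leading 0 can be deleted, which lowers the first count by one. *)
case: b => IH.
  rewrite /= [LHS]big_ord_recl /=.
  rewrite [X in X + _ = _](_ : _ = 0); last first.
    rewrite -[RHS](wsum0 l.+1 x); apply: eq_wsum => g _ _; exact: mulr0.
  rewrite add0r.
  rewrite [RHS]big_ord_recl /= drop0 mul1r.
  rewrite [X in _ = _ + X]big1 ?addr0 => [|a _]; last by rewrite mul0r.
  transitivity (Y l x.+1 (fun b => F (incr1 (0%N :: b))) u); last by [].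
  rewrite -(Y_first l (fun a => F (incr1 a)) su).
  by apply: eq_bigr => i _; apply: eq_wsum => g _ _; rewrite cnt_cons0.
transitivity (Y l.+1 x.+1 (fun a => F (incr1 a)) u).
  apply: eq_bigr => i _; apply: eq_wsum => g _ _; rewrite cnt_cons0 /cstep.
  by case: (i : nat) => //= ? ; rewrite ?eqxx ?orbT.
rewrite IH; apply: eq_bigr => a _; congr (_ * _).
by case: a => -[|a] /=; rewrite ?take0.
Qed.

(** Only one weakly increasing labelling has the counts [r], the one constant on the blocks of [r];
    it is admissible when no descent of [u] is interior to a block. *)
Lemma Y_inclb r u : size u = (sumn r).-1 ->
  Y (size r) (sumn r) (fun a => (a == r)%:R) u = (inclb u r)%:R.
Proof.
elim: r u => [|x r IHr] u su; first by rewrite /Y /= (size0nil su) mulr1.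
rewrite [size _]/= Y_rec // /=.
have lt_x : (x < (x + sumn r).+1)%N by rewrite ltnS leq_addr.
rewrite (bigD1 (Ordinal lt_x)) //= big1 ?addr0 => [|a ax]; last first.
  rewrite [X in _ * X](_ : _ = 0) ?mulr0 // /Y -[RHS](wsum0 (size r) (x + sumn r - a)).
  apply: eq_wsum => g _ _; rewrite eqseq_cons.
  by rewrite -(inj_eq val_inj) /= in ax; rewrite (negPf ax) mul0r.
rewrite addKn -mulnb natrM; congr (_ * _).
rewrite -IHr; last by rewrite size_drop su /=; lia.
by apply: eq_wsum => g _ _; rewrite eqseq_cons eqxx.
Qed.

Lemma cnt_cat l g h :
  cnt l (g ++ h) = [seq (p.1 + p.2)%N | p <- zip (cnt l g) (cnt l h)].
Proof.
rewrite /cnt /mkseq zip_map -map_comp; apply: eq_map => i /=.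
by rewrite count_cat.
Qed.

(** The analogue of [Y] in which labels have to increase only inside each block of [q]; the counts
    are taken over all blocks together. *)
Definition B l q (F : seq nat -> K) (w : bitseq) : K :=
  wsum l (sumn q) (fun g => F (cnt l g) * (inclb (cword no_dir w g) q)%:R).

Definition addc (a b : seq nat) := [seq (p.1 + p.2)%N | p <- zip a b].

(** [F] sees the total counts and so couples the blocks. Fixing the counts [a] of the first block
    turns each term into a product of the shape occurring in [star_W]. *)
Lemma B_cons l x q F w : (0 < x)%N -> posword q -> size w = (x + sumn q).-1 ->
  B l (x :: q) F w = \sum_(a : l.-tuple 'I_x.+1)
    Y l x (fun b => (b == map (@nat_of_ord _) a)%:R) (take x.-1 w) *
    B l q (fun b => F (addc (map (@nat_of_ord _) a) b)) (drop x w).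
Proof.
move=> x_gt0 pos_q sw; rewrite /B /Y /= wsum_cat.
transitivity (wsum l x (fun g => \sum_(a : l.-tuple 'I_x.+1)
   B l q (fun b => F (addc (map (@nat_of_ord _) a) b)) (drop x w) *
   ((cnt l g == map (@nat_of_ord _) a)%:R *
   (all negb (cword no_dir (take x.-1 w) g))%:R))); last first.
  by rewrite wsum_sum; apply: eq_bigr => a _; rewrite wsum_mull mulrC.
apply: eq_wsum => g sg _.
(* Each count is at most [x], so the counts of [g] form one of the tuples summed over, and no other
   term survives. *)
have lt_c i : (count_mem i g < x.+1)%N by rewrite ltnS -sg count_size.
have szc : size (mkseq (fun i => Ordinal (lt_c i)) l) == l by rewrite size_mkseq.
have cE : map (@nat_of_ord _) (Tuple szc) = cnt l g by rewrite /= -map_comp.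
rewrite (bigD1 (Tuple szc)) //= cE eqxx big1 ?addr0 => [|a na]; last first.
  case: eqP => [e|_]; last by rewrite mul0r mulr0.
  case/eqP: na; apply: val_inj; apply: (inj_map val_inj); rewrite -e -cE //.
rewrite mul1r mulrC /B -wsum_mull; apply: eq_wsum => h sh _.
by rewrite -[_ && _]/(inclb _ (x :: q)) inclb_cword_cat // -mulnb natrM cnt_cat; ring.
Qed.

(** By [Y_inclb] the coefficients of [Xi r] count labellings with counts [r]. These counts do not
    change under rearrangement, so [count_products] applies. *)
Lemma Xi_inner_Xi n q r : composition n q -> composition n r ->
  inner_perm (Xi K q) (Xi K r) = W n (B (size r) q (fun a => (a == r)%:R)).
Proof.
move=> comp_q comp_r; rewrite (Xi_comp _ comp_q) (Xi_comp _ comp_r) inner_W.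
case/andP: comp_q comp_r => pos_q /eqP <- /andP[_ /eqP sr]; apply: fun_elt_ext => t.
rewrite /B -count_products => [|g h gh]; last first.
  by congr ((_ == _)%:R); apply: eq_map => i; apply/seq.permP.
apply: eq_bigr => s _; congr (_ * _).
by rewrite -Y_inclb ?size_dword ?sr.
Qed.

End InnerProductOfWords.

(** * Cycle types and their invariance under conjugation *)

Section CycleTypes.

(** Swaps of neighbouring letters generate all rearrangements. *)
Lemma perm_eq_rel_ind (R : seq nat -> seq nat -> Prop) :
  R [::] [::] -> (forall x p q, R p q -> R (x :: p) (x :: q)) ->
  (forall x y p, R [:: x, y & p] [:: y, x & p]) ->
  (forall p q r, R p q -> R q r -> R p r) ->
  forall p q, perm_eq p q -> R p q.
Proof.
move=> R0 Rc Rs Rt; have Rr p : R p p by elim: p => // x p; apply: Rc.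
elim=> [|x p IHp] q; first by rewrite perm_sym => /perm_nilP->.
move=> pq; have xq : x \in q by rewrite -(perm_mem pq) mem_head.
case/splitPr: xq pq => q1 q2; rewrite -[x :: q2]cat1s perm_sym perm_catCA.
rewrite perm_cons perm_sym => pq.
apply: (Rt _ _ _ (Rc x _ _ (IHp _ pq))).
elim: q1 {IHp pq} => //= y q1 IH; exact: (Rt _ _ _ (Rs _ _ _) (Rc _ _ _ IH)).
Qed.

Lemma porbits_partition n (s : 'S_n) : partition (porbits s) [set: 'I_n].
Proof.
have -> : porbits s = [set orbit 'P <[s]> x | x in [set: 'I_n]].
  rewrite /porbits; apply/setP => B; apply/imsetP/imsetP => -[x _ ->];
    by exists x; rewrite ?inE // porbit.unlock /orbit.
apply: orbit_partition; apply/actsP => a _ x; by rewrite !inE.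
Qed.

Lemma sumn_cycle_type n (s : 'S_n) : sumn (cycle_type s) = n.
Proof.
rewrite sumnE big_map big_enum /= -(card_partition (porbits_partition s)).
by rewrite cardsT card_ord.
Qed.

Lemma cycle_type_pos n (s : 'S_n) : posword (cycle_type s).
Proof.
apply/allP => k /mapP[B]; rewrite mem_enum => /imsetP[x _ ->] ->.
by rewrite lt0n card_porbit_neq0.
Qed.

Lemma porbitJ n (s t : 'S_n) x : porbit (s ^ t)%g (t x) = t @: porbit s x.
Proof.
apply/setP => y; apply/porbitP/imsetP => [[i ->]|[_ /porbitP[i ->] ->]].
  by exists ((s ^+ i)%g x); rewrite ?mem_porbit // -conjXg permJ.
by exists i; rewrite -conjXg permJ.
Qed.

Lemma cycle_typeJ n (s t : 'S_n) : perm_eq (cycle_type (s ^ t)%g) (cycle_type s).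
Proof.
have t_inj : injective (fun B : {set 'I_n} => t @: B) := imset_inj (@perm_inj _ t).
have orbJ : porbits (s ^ t)%g = (fun B : {set 'I_n} => t @: B) @: porbits s.
  apply/setP => B; apply/imsetP/imsetP => [[x _ ->]|[_ /imsetP[x _ ->] ->]].
    exists (porbit s (t^-1%g x)); first exact: imset_f.
    by rewrite -porbitJ permKV.
  by exists (t x); rewrite ?porbitJ.
have e : perm_eq (enum (porbits (s ^ t)%g))
    [seq t @: (B : {set 'I_n}) | B <- enum (porbits s)].
  apply: uniq_perm; rewrite ?(map_inj_uniq t_inj) ?enum_uniq // => B.
  rewrite mem_enum orbJ; apply/imsetP/mapP => -[C]; rewrite ?mem_enum => C1 C2;
    by exists C; rewrite ?mem_enum.
rewrite /cycle_type (perm_trans (perm_map _ e)) // -map_comp.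
by rewrite (eq_map (g := fun B : {set 'I_n} => #|B|)) // => B /=; rewrite card_imset //; apply: perm_inj.
Qed.

End CycleTypes.

(** * The centraliser orders [qfact] *)

Section Qfact.

Let term q i := ((count_mem i q)`! * i ^ count_mem i q)%N.

(** The range in [qfact] depends on [q]. Widening it, at the cost of factors [0! * i ^ 0], allows
    comparing [qfact] at two words. *)
Let qfact_wide M q : (sumn q < M)%N -> qfact q = (\prod_(1 <= i < M) term q i)%N.
Proof.
move=> lt_M; rewrite [RHS](@big_cat_nat _ _ _ (sumn q).+1) //= [X in (_ * X)%N]big_nat_cond.
rewrite [X in (_ * X)%N]big1 ?muln1 // => i /andP[/andP[lt_i _] _].
rewrite /term (_ : count_mem i q = 0%N) //; apply/count_memPn/negP => iq.
by move: lt_i; rewrite (perm_sumn (perm_to_rem iq)) /= ltnNge leq_addr.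
Qed.

Lemma qfact_cons x q : (0 < x)%N ->
  qfact (x :: q) = ((count_mem x q).+1 * x * qfact q)%N.
Proof.
move=> x_gt0; pose M := (x + sumn q).+1.
have ltM1 : (sumn (x :: q) < M)%N by [].
have ltM2 : (sumn q < M)%N by rewrite ltnS leq_addl.
rewrite (qfact_wide ltM1) (qfact_wide ltM2).
have xM : x \in index_iota 1 M by rewrite mem_index_iota x_gt0 ltnS leq_addr.
rewrite !(bigD1_seq x) ?iota_uniq //= mulnA; congr (_ * _)%N.
  by rewrite /term /= eqxx add1n factS expnS; ring.
by apply: eq_bigr => i ix; rewrite /term /= eq_sym (negPf ix).
Qed.

Lemma qfact_gt0 q : posword q -> (0 < qfact q)%N.
Proof.
elim: q => [|x q IHq] /=; first by rewrite /qfact big_geq.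
by case/andP=> x_gt0 /IHq q_gt0; rewrite qfact_cons // !muln_gt0 x_gt0.
Qed.

Lemma qfact_perm p q : perm_eq p q -> qfact p = qfact q.
Proof.
move=> pq; rewrite /qfact (perm_sumn pq); apply: eq_bigr => i _.
by rewrite !(seq.permP pq).
Qed.

End Qfact.

(** * Splittings of a cycle type into two *)

Section Splittings.
Variable K : fieldType.

(* Sum over the ways to split a word into two complementary subwords. *)
Fixpoint msum (p : seq nat) (G : seq nat -> seq nat -> K) : K :=
  if p is x :: p' then
    msum p' (fun u v => G (x :: u) v) + msum p' (fun u v => G u (x :: v))
  else G [::] [::].

Lemma eq_msum p G H : (forall u v, perm_eq (u ++ v) p -> G u v = H u v) ->
  msum p G = msum p H.
Proof.
elim: p G H => [|x p IHp] G H eGH /=; first exact: eGH.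
congr (_ + _); apply: IHp => u v uv; apply: eGH; first by rewrite /= perm_cons.
by rewrite perm_catC /= perm_cons perm_catC.
Qed.

Lemma msumZ a p G : msum p (fun u v => a * G u v) = a * msum p G.
Proof. by elim: p G => //= x p IHp G; rewrite !IHp mulrDr. Qed.

Lemma msum_sum (I : Type) (r : seq I) (P : pred I) p (G : I -> seq nat -> seq nat -> K) :
  msum p (fun u v => \sum_(i <- r | P i) G i u v) = \sum_(i <- r | P i) msum p (G i).
Proof. by elim: p G => //= x p IHp G; rewrite !IHp -big_split. Qed.

Definition pinv (f : seq nat -> K) := forall p q, perm_eq p q -> f p = f q.

Lemma msum_perm p q (G : seq nat -> seq nat -> K) :
  (forall u u' v v', perm_eq u u' -> perm_eq v v' -> G u v = G u' v') ->
  perm_eq p q -> msum p G = msum q G.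
Proof.
pose inv (G : seq nat -> seq nat -> K) :=
  forall u u' v v', perm_eq u u' -> perm_eq v v' -> G u v = G u' v'.
move=> Ginv pq; move: pq G Ginv.
apply: (perm_eq_rel_ind (R := fun p q => forall G, inv G -> msum p G = msum q G)) => {p q} //=.
- move=> x p q IH G Ginv; congr (_ + _); apply: IH => u u' v v' uu' vv'; apply: Ginv => //;
    by rewrite perm_cons.
- move=> x y p G Ginv; rewrite [RHS]addrACA.
  have swap (u : seq nat) : perm_eq [:: x, y & u] [:: y, x & u].
    by apply/seq.permP => a /=; rewrite addnCA.
  by congr (_ + _ + (_ + _)); apply: eq_msum => u v _; apply: Ginv.
- by move=> p q r IH1 IH2 G Ginv; rewrite IH1 // IH2.
Qed.

Lemma perm_consE x (u p : seq nat) :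
  perm_eq (x :: u) p = (x \in p) && perm_eq u (rem x p).
Proof.
have [xp|xp] := boolP (x \in p); last first.
  by apply/negP => e; case/negP: xp; rewrite -(perm_mem e) mem_head.
by rewrite (permPr (perm_to_rem xp)) perm_cons.
Qed.

Lemma posword_rem x p : posword p -> posword (rem x p).
Proof. by apply: contraTT => /allPn[i /mem_rem ip ni]; apply/allPn; exists i. Qed.

(* The quotient of the [qfact]s counts the ways to select cycles of type [p]
   from a permutation of cycle type [p ++ r]. *)
Lemma msum_qfact t p r : posword p -> posword r ->
  (qfact p)%:R * (qfact r)%:R *
    msum t (fun u v => (perm_eq u p)%:R * (perm_eq v r)%:R)
  = (qfact (p ++ r))%:R * (perm_eq t (p ++ r))%:R :> K.
Proof.
elim: t p r => [|x t IHt] p r pos_p pos_r /=.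
  have nil_cons y (s : seq nat) : perm_eq [::] (y :: s) = false.
    by apply/negP => /perm_size.
  case: p pos_p => [|y p] pos_p; last by rewrite !nil_cons mul0r !mulr0.
  case: r pos_r => [|y r] pos_r; last by rewrite !nil_cons !mulr0.
  by rewrite /qfact !big_geq // !mulr1.
(* If the part [x] is sent to the first word, it is struck from [p], and [qfact p] releases [x]
   times the multiplicity of [x] in [p]. *)
have split1 : (qfact p)%:R * (qfact r)%:R *
    msum t (fun u v => (perm_eq (x :: u) p)%:R * (perm_eq v r)%:R) =
    (x \in p)%:R * ((count_mem x p * x)%:R * ((qfact (rem x p ++ r))%:R * (perm_eq t (rem x p ++ r))%:R)) :> K.
  have [xp|xp] := boolP (x \in p); last first.
    rewrite mul0r (@eq_msum _ _ (fun _ _ => 0 * 0)) => [|u v _].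
      by rewrite msumZ mul0r mulr0.
    by rewrite perm_consE (negPf xp) !mul0r.
  have x_gt0 : (0 < x)%N by move/allP: pos_p => /(_ x xp).
  rewrite -IHt ?posword_rem // mul1r (qfact_perm (perm_to_rem xp)) qfact_cons //.
  rewrite (seq.permP (perm_to_rem xp)) /= eqxx add1n.
  rewrite (@eq_msum _ _ (fun u v => (perm_eq u (rem x p))%:R * (perm_eq v r)%:R)) => [|u v _].
    by rewrite !natrM; ring.
  by rewrite perm_consE xp.
have split2 : (qfact p)%:R * (qfact r)%:R *
    msum t (fun u v => (perm_eq u p)%:R * (perm_eq (x :: v) r)%:R) =
    (x \in r)%:R * ((count_mem x r * x)%:R * ((qfact (p ++ rem x r))%:R * (perm_eq t (p ++ rem x r))%:R)) :> K.
  have [xr|xr] := boolP (x \in r); last first.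
    rewrite mul0r (@eq_msum _ _ (fun _ _ => 0 * 0)) => [|u v _].
      by rewrite msumZ mul0r mulr0.
    by rewrite perm_consE (negPf xr) mulr0 mul0r.
  have x_gt0 : (0 < x)%N by move/allP: pos_r => /(_ x xr).
  rewrite -IHt ?posword_rem // mul1r (qfact_perm (perm_to_rem xr)) qfact_cons //.
  rewrite (seq.permP (perm_to_rem xr)) /= eqxx add1n.
  rewrite (@eq_msum _ _ (fun u v => (perm_eq u p)%:R * (perm_eq v (rem x r))%:R)) => [|u v _].
    by rewrite !natrM; ring.
  by rewrite perm_consE xr.
rewrite mulrDr split1 split2 perm_consE mem_cat.
have pr1 : x \in p -> perm_eq (p ++ r) (x :: (rem x p ++ r)).
  by move=> xp; rewrite -cat_cons perm_cat2r perm_to_rem.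
have pr2 : x \in r -> perm_eq (p ++ r) (x :: (p ++ rem x r)).
  by move=> xr; rewrite -[x :: _]cat1s perm_sym perm_catCA perm_cat2l perm_sym perm_to_rem.
have rem1 : x \in p -> perm_eq (rem x (p ++ r)) (rem x p ++ r).
  move=> xp; rewrite -(perm_cons x) -(permPl (perm_to_rem _)) ?pr1 //.
  by rewrite mem_cat xp.
have rem2 : x \in r -> perm_eq (rem x (p ++ r)) (p ++ rem x r).
  move=> xr; rewrite -(perm_cons x) -(permPl (perm_to_rem _)) ?pr2 //.
  by rewrite mem_cat xr orbT.
have [/orP xpr|] := boolP ((x \in p) || (x \in r)); last first.
  by rewrite negb_or => /andP[/negPf-> /negPf->]; rewrite !mul0r mulr0 addr0.
have xcat : x \in p ++ r by rewrite mem_cat; apply/orP.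
have x_gt0 : (0 < x)%N by case: xpr => [/(allP pos_p)|/(allP pos_r)].
set e := perm_eq t (rem x (p ++ r)); set Z : K := (qfact (rem x (p ++ r)))%:R.
have t1 : (x \in p)%:R * ((count_mem x p * x)%:R * ((qfact (rem x p ++ r))%:R *
    (perm_eq t (rem x p ++ r))%:R)) = (count_mem x p * x)%:R * (Z * e%:R) :> K.
  have [xp|/count_memPn->] := boolP (x \in p); last by rewrite !mul0r.
  by rewrite mul1r -(qfact_perm (rem1 xp)) -(permPr (rem1 xp)).
have t2 : (x \in r)%:R * ((count_mem x r * x)%:R * ((qfact (p ++ rem x r))%:R *
    (perm_eq t (p ++ rem x r))%:R)) = (count_mem x r * x)%:R * (Z * e%:R) :> K.
  have [xr|/count_memPn->] := boolP (x \in r); last by rewrite !mul0r.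
  by rewrite mul1r -(qfact_perm (rem2 xr)) -(permPr (rem2 xr)).
rewrite t1 t2 (qfact_perm (perm_to_rem xcat)) qfact_cons //.
(* Both contributions now carry the same remainder, and their multiplicities of [x] add up to the
   one required by [qfact (p ++ r)]. *)
have -> : (count_mem x (rem x (p ++ r))).+1 = (count_mem x p + count_mem x r)%N.
  by rewrite -count_cat (seq.permP (perm_to_rem xcat)) /= eqxx.
by rewrite !natrM natrD /Z; ring.
Qed.

End Splittings.

(** * Functions of the cycle type and the outer product on them *)

Section ClassFunctions.
Variable K : fieldType.

Lemma leq_size_sumn t : posword t -> (size t <= sumn t)%N.
Proof. by elim: t => //= x t IHt /andP[x_gt0 /IHt]; lia. Qed.

Lemma leq_mem_sumn x t : x \in t -> (x <= sumn t)%N.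
Proof. by move=> xt; rewrite (perm_sumn (perm_to_rem xt)) /= leq_addr. Qed.

(** A partition of [n] has at most [n] parts, each at most [n], so these bounded sequences include
    all of them; only the sorted form of [t] contributes. *)
Lemma partition_sum n t (phi : seq nat -> K) : posword t -> pinv phi ->
  \sum_(p : n.-bseq 'I_n.+1 | sorted geq [seq val i | i <- p]
                              && composition n [seq val i | i <- p])
     (perm_eq t [seq val i | i <- p])%:R * phi [seq val i | i <- p]
  = (sumn t == n)%:R * phi t.
Proof.
move=> pos_t phi_inv; have [sum_t|nsum_t] := eqVneq (sumn t) n; last first.
  rewrite mul0r big1 // => p /andP[_ /andP[_ /eqP sum_p]].
  rewrite (_ : perm_eq _ _ = false) ?mul0r //; apply: contraNF nsum_t => /perm_sumn ->.
  exact/eqP.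
have tsort : perm_eq t (sort geq t) by rewrite perm_sym perm_sort.
have sz : (size [seq (inord i : 'I_n.+1) | i <- sort geq t] <= n)%N.
  by rewrite size_map size_sort -sum_t leq_size_sumn.
have pE : [seq val i | i <- Bseq sz] = sort geq t.
  rewrite /= -map_comp map_id_in // => i; rewrite mem_sort => it /=.
  by rewrite inordK // ltnS -sum_t leq_mem_sumn.
have geq_tr : transitive geq by move=> a b c /= ba cb; apply: leq_trans cb ba.
have geq_anti : antisymmetric geq by move=> a b /= /andP[? ?]; apply/eqP; rewrite eqn_leq; apply/andP.
rewrite (bigD1 (Bseq sz)) /=; last first.
  rewrite pE sort_sorted; last by move=> a b; apply: leq_total.
  rewrite /composition -(perm_sumn tsort) sum_t eqxx andbT.
  by rewrite /posword -(perm_all _ tsort).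
rewrite pE tsort (phi_inv _ _ tsort) big1 ?addr0 // => p /andP[/andP[srt _] np].
case: (boolP (perm_eq _ _)) => [tp|_]; last by rewrite mul0r.
case/eqP: np; apply: val_inj; apply: (inj_map val_inj).
rewrite [RHS]pE; apply: (sorted_eq geq_tr geq_anti srt).
  by apply: sort_sorted => a b; apply: leq_total.
by rewrite -(permPl tp).
Qed.

Definition T n (phi : seq nat -> K) : KS K :=
  fun_elt (fun s : 'S_n => phi (cycle_type s)).

Definition ctype (g : gperm) : seq nat := cycle_type (tagged g).

Lemma ctype_pos g : posword (ctype g). Proof. exact: cycle_type_pos. Qed.

Lemma sumn_ctype g : sumn (ctype g) = tag g. Proof. exact: sumn_cycle_type. Qed.

Lemma T_coef n phi g : (T n phi)@_g = (tag g == n)%:R * phi (ctype g).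
Proof. exact: (mcoeff_fun_elt_tag n (fun m s => phi (@cycle_type m s))). Qed.

Lemma T_ext n phi psi :
  (forall p, posword p -> sumn p = n -> phi p = psi p) -> T n phi = T n psi.
Proof.
by move=> e; apply: fun_elt_ext => s; rewrite e ?cycle_type_pos ?sumn_cycle_type.
Qed.

Lemma T_lin n a phi psi :
  T n (fun p => a * phi p + psi p) = a *: T n phi + T n psi.
Proof. exact: fun_elt_lin. Qed.

Lemma T0 n : T n (fun=> 0) = 0.
Proof. by apply/malgP => g; rewrite T_coef mulr0 mcoeff0. Qed.

Lemma TZ n a phi : T n (fun p => a * phi p) = a *: T n phi.
Proof.
rewrite -[RHS]addr0 -(T0 n) -T_lin.
by apply: T_ext => p _ _; rewrite addr0.
Qed.

Lemma TD n phi psi : T n (fun p => phi p + psi p) = T n phi + T n psi.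
Proof.
rewrite -[T n phi in RHS]scale1r -T_lin.
by apply: T_ext => p _ _; rewrite mul1r.
Qed.

Lemma T_sum n (I : Type) (r : seq I) (P : pred I) (F : I -> seq nat -> K) :
  T n (fun p => \sum_(i <- r | P i) F i p) = \sum_(i <- r | P i) T n (F i).
Proof.
elim: r => [|i r IHr].
  by rewrite big_nil -(T0 n); apply: T_ext => p _ _; rewrite big_nil.
rewrite big_cons -IHr; case: ifP => Pi; rewrite -?TD;
  by apply: T_ext => p _ _; rewrite big_cons Pi.
Qed.

Lemma char_coef q g : (char K q)@_g = (perm_eq (ctype g) q)%:R.
Proof.
rewrite /char /set_elt (mcoeff_fun_elt_tag _ (fun m s => (perm_eq (@cycle_type m s) q)%:R)).
case: eqP => [_|nq]; first by rewrite mul1r.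
rewrite mul0r (_ : perm_eq _ _ = false) //; apply: contra_notF nq => /perm_sumn.
by rewrite sumn_ctype.
Qed.

Lemma char_T q : char K q = T (sumn q) (fun p => (perm_eq p q)%:R).
Proof. by []. Qed.

Lemma triv_char_T n : triv_char K n = T n (fun=> 1).
Proof. by []. Qed.

Lemma Cn_subspace n : subspace (@Cn K n).
Proof.
split=> [|a _ _ [f fJ ->] [h hJ ->]].
  exists (fun=> 0) => //; apply/malgP => g.
  by rewrite mcoeff0 (mcoeff_fun_elt_tag _ (fun _ _ => 0)) mulr0.
by exists (fun s => a * f s + h s) => [s t|]; rewrite ?fJ ?hJ ?fun_elt_lin.
Qed.

Lemma Call_subspace : subspace (@Call K).
Proof. exact/dsum_subspace/Cn_subspace. Qed.

Lemma Call_T n phi : pinv phi -> Call (T n phi).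
Proof.
move=> phi_inv; apply: (dsum_gen (n := n)); first exact: Cn_subspace.
by exists (fun s : 'S_n => phi (cycle_type s)) => // s t; apply/phi_inv/cycle_typeJ.
Qed.

Lemma pinv_perm_eq q : pinv (fun p => (perm_eq p q)%:R : K).
Proof. by move=> p r pr; rewrite (permPl pr). Qed.

Lemma Call_char q : Call (char K q).
Proof. by rewrite char_T; apply/Call_T/pinv_perm_eq. Qed.

Lemma Call_ch q : Call (ch K q).
Proof. exact: (subspaceZ _ Call_subspace (Call_char q)). Qed.

Lemma T_char_sum n phi : pinv phi -> T n phi =
  \sum_(p : n.-bseq 'I_n.+1 | sorted geq [seq val i | i <- p]
                              && composition n [seq val i | i <- p])
     phi [seq val i | i <- p] *: char K [seq val i | i <- p].
Proof.
move=> phi_inv; apply/malgP => g; rewrite T_coef raddf_sum /= -sumn_ctype.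
rewrite -(partition_sum _ (ctype_pos g) phi_inv); apply: eq_bigr => p _.
by rewrite mcoeffZ char_coef mulrC.
Qed.

Lemma Codd_subspace : subspace (@Codd K). Proof. exact: lspan_subspace. Qed.

Lemma Codd_Call (x : KS K) : Codd x -> Call x.
Proof.
apply: (lspan_min Call_subspace) => _ [q _ ->]; exact: Call_char.
Qed.

Lemma Codd_inner (x y : KS K) : Codd x -> Codd y -> Codd (inner_class x y).
Proof.
have bil := @inner_class_bilinear K (@Call K).
apply: (bilinear_on_lspan Call_subspace bil Codd_subspace).
- by move=> _ [q _ ->]; apply: Call_char.
- by move=> _ [q _ ->]; apply: Call_char.
move=> _ _ [q oq ->] [r _ ->].
have -> : inner_class (char K q) (char K r) = (perm_eq q r)%:R *: char K q.
  apply/malgP => g; rewrite mcoeffZ inner_class_coef !char_coef.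
  have [gq|_] := boolP (perm_eq _ q); last by rewrite mul0r mulr0.
  by rewrite mul1r mulr1 -(permPl gq).
by apply: subspaceZ; [exact: Codd_subspace | apply: lspan_gen; exists q].
Qed.

Lemma inner_T n (phi psi : seq nat -> K) :
  inner_class (T n phi) (T n psi) = T n (fun p => phi p * psi p).
Proof.
apply/malgP => g; rewrite inner_class_coef !T_coef.
by case: eqP => _; rewrite ?mul0r // !mul1r.
Qed.

Lemma inner_T_neq n m (phi psi : seq nat -> K) : n != m ->
  inner_class (T n phi) (T m psi) = 0.
Proof.
move=> nm; apply/malgP => g; rewrite inner_class_coef !T_coef mcoeff0.
by have [->|_] := eqVneq (tag g) n; rewrite ?(negPf nm) ?mul0r ?mulr0.
Qed.

Hypothesis char0 : [pchar K] =i pred0.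

Lemma qfact_neq0 q : posword q -> (qfact q)%:R != 0 :> K.
Proof. by move=> pos_q; rewrite natr_neq0 // qfact_gt0. Qed.

Lemma char_ch q : posword q -> char K q = (qfact q)%:R^-1 *: ch K q.
Proof. by move=> pos_q; rewrite /ch scalerA mulVf ?scale1r ?qfact_neq0. Qed.

Variable bullet : KS K -> KS K -> KS K.
Hypothesis Hbullet : is_outer_C bullet.

(** This is the formula for an induced product. Both factors are expanded in the [ch] of partitions,
    which [bullet] concatenates, and [msum_qfact] reads the result as a count of splittings. *)
Lemma bullet_T n m phi psi : pinv phi -> pinv psi ->
  bullet (T n phi) (T m psi) =
  T (n + m) (fun p => msum p (fun u v =>
    (sumn u == n)%:R * phi u * ((sumn v == m)%:R * psi v))).
Proof.
move=> phi_inv psi_inv; have [[linr linl] bullet_ch] := Hbullet.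
have sC := Call_subspace; have CZ a q : Call (a *: char K q).
  exact: (subspaceZ _ sC (Call_char q)).
rewrite (T_char_sum n phi_inv) (T_char_sum m psi_inv).
set s2 := \sum_(p : m.-bseq _ | _) _; have Cs2 : Call s2.
  by apply: subspace_sum => // p _; apply: CZ.
rewrite (linear_on_sum sC (linl _ Cs2)) => [|p _]; last exact: CZ.
apply/malgP => g; rewrite raddf_sum T_coef /=.
transitivity (\sum_(p : n.-bseq 'I_n.+1 | sorted geq [seq val i | i <- p]
      && composition n [seq val i | i <- p])
    \sum_(r : m.-bseq 'I_m.+1 | sorted geq [seq val i | i <- r]
      && composition m [seq val i | i <- r])
    msum (ctype g) (fun u v => (perm_eq u [seq val i | i <- p])%:R * phi [seq val i | i <- p] *
      ((perm_eq v [seq val i | i <- r])%:R * psi [seq val i | i <- r]))).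
  apply: eq_bigr => p /andP[_ /andP[pos_p _]].
  rewrite (linear_onZ sC (linl _ Cs2)); last exact: Call_char.
  rewrite (linear_on_sum sC (linr _ (Call_char _))) => [|r _]; last exact: CZ.
  rewrite scaler_sumr raddf_sum /=; apply: eq_bigr => r /andP[_ /andP[pos_r _]].
  rewrite (linear_onZ sC (linr _ (Call_char _))); last exact: Call_char.
  rewrite !mcoeffZ.
  set pw := [seq val i | i <- p] in pos_p *; set rw := [seq val i | i <- r] in pos_r *.
  have zp := qfact_neq0 pos_p; have zr := qfact_neq0 pos_r.
  have -> : bullet (char K pw) (char K rw) =
      ((qfact pw)%:R^-1 * (qfact rw)%:R^-1) *: ch K (pw ++ rw).
    rewrite (char_ch pos_p) (linear_onZ sC (linl _ _)); [|exact: Call_char|exact: Call_ch].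
    rewrite (char_ch pos_r) (linear_onZ sC (linr _ _)); [|exact: Call_ch|exact: Call_ch].
    by rewrite bullet_ch // scalerA.
  rewrite mcoeffZ /ch mcoeffZ char_coef -(msum_qfact K (ctype g) pos_p pos_r).
  rewrite -!msumZ; apply: eq_msum => u v _.
  by field; rewrite zp zr.
under eq_bigr => p _ do rewrite -msum_sum.
rewrite -msum_sum -msumZ; apply: eq_msum => u v uv.
have [pos_u pos_v] : posword u /\ posword v.
  by apply/andP; rewrite -all_cat (perm_all _ uv); apply: ctype_pos.
under eq_bigr => p _ do rewrite -mulr_sumr.
rewrite -mulr_suml (partition_sum _ pos_u phi_inv) (partition_sum _ pos_v psi_inv).
have := perm_sumn uv; rewrite sumn_cat sumn_ctype => <-.
have [->|_] := eqVneq (sumn u) n; last by rewrite !mul0r mulr0.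
have [->|_] := eqVneq (sumn v) m; last by rewrite mul0r !mulr0.
by rewrite eqxx !mul1r.
Qed.

Lemma Codd_bullet (x y : KS K) : Codd x -> Codd y -> Codd (bullet x y).
Proof.
have [bil bullet_ch] := Hbullet.
apply: (bilinear_on_lspan Call_subspace bil Codd_subspace).
- by move=> _ [q _ ->]; apply: Call_char.
- by move=> _ [q _ ->]; apply: Call_char.
have odd_pos (q : seq nat) : oddword q -> posword q by apply: sub_all => -[].
move=> _ _ [q oq ->] [r or ->]; have sC := Call_subspace.
have [linr linl] := bil.
rewrite (char_ch (odd_pos _ oq)) (linear_onZ sC (linl _ (Call_char r)) _ (Call_ch q)).
rewrite (char_ch (odd_pos _ or)) (linear_onZ sC (linr _ (Call_ch q)) _ (Call_ch r)).
rewrite bullet_ch ?odd_pos // /ch !scalerA.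
apply: subspaceZ; first exact: Codd_subspace.
apply: lspan_gen; exists (q ++ r) => //.
by rewrite /oddword all_cat; apply/andP.
Qed.

End ClassFunctions.

(** * Labellings of cycles and Young characters *)

Section LabelledCycles.
Variable K : fieldType.

Fixpoint addat (i x : nat) (c : seq nat) {struct c} : seq nat :=
  if c is y :: c' then if i is j.+1 then y :: addat j x c' else (x + y)%N :: c'
  else [::].

(* Sum over the labelings of the parts of [p] by the letters below [l]; [F]
   receives the list of the total sizes of the parts with each label. *)
Fixpoint lsum l (p : seq nat) (F : seq nat -> K) : K :=
  if p is x :: p' then \sum_(i < l) lsum l p' (fun c => F (addat i x c))
  else F (nseq l 0%N).

Lemma size_addat i x c : size (addat i x c) = size c.
Proof. by elim: c i => // y c IHc [|i] //=; rewrite IHc. Qed.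

Lemma addatC i j x y c : addat i x (addat j y c) = addat j y (addat i x c).
Proof.
by elim: c i j => // z c IHc [|i] [|j] //=; rewrite ?IHc // !addnA [(x + y)%N]addnC.
Qed.

Lemma addat_addcl i x c d : addat i x (addc c d) = addc (addat i x c) d.
Proof.
rewrite /addc; elim: c d i => [|y c IHc] [|z d] [|i] //=; first by rewrite addnA.
by rewrite IHc.
Qed.

Lemma addat_addcr i x c d : addat i x (addc c d) = addc c (addat i x d).
Proof.
rewrite /addc; elim: c d i => [|y c IHc] [|z d] [|i] //=; first by rewrite addnCA.
by rewrite IHc.
Qed.

Lemma eq_lsum l p F G :
  (forall c, size c = l -> all (fun y => y <= sumn p)%N c -> F c = G c) ->
  lsum l p F = lsum l p G.
Proof.
elim: p F G => [|x p IHp] F G eFG /=.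
  by apply: eFG; rewrite ?size_nseq // all_nseq leqnn orbT.
apply: eq_bigr => i _; apply: IHp => c sc ac; apply: eFG; first by rewrite size_addat.
elim: c (i : nat) {sc} ac => // y c IHc [|j] /= /andP[le_y ac].
  rewrite leq_add2l le_y; apply: sub_all ac => z /leq_trans; apply.
  exact: leq_addl.
by rewrite IHc // (leq_trans le_y) // leq_addl.
Qed.

Lemma lsumZ l p a F : lsum l p (fun c => a * F c) = a * lsum l p F.
Proof.
elim: p F => //= x p IHp F; rewrite mulr_sumr; apply: eq_bigr => i _; exact: IHp.
Qed.

Lemma lsum_sum l p (I : Type) (r : seq I) (F : I -> seq nat -> K) :
  lsum l p (fun c => \sum_(i <- r) F i c) = \sum_(i <- r) lsum l p (F i).
Proof.
elim: p F => //= x p IHp F; rewrite exchange_big; apply: eq_bigr => i _; exact: IHp.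
Qed.

Lemma lsum_perm l F : pinv (fun p => lsum l p F).
Proof.
move=> p q pq; move: pq F.
apply: (perm_eq_rel_ind (R := fun p q => forall F, lsum l p F = lsum l q F)) => {p q} //=.
- by move=> x p q IH F; apply: eq_bigr => i _.
- move=> x y p F; rewrite exchange_big; apply: eq_bigr => i _; apply: eq_bigr => j _.
  by apply: eq_lsum => c _ _; rewrite addatC.
- by move=> p q r IH1 IH2 F; rewrite IH1.
Qed.

(** The parts labelled 0 form [u]. This is the counterpart of [Y_rec], and [c_Y] matches the two. *)
Lemma lsum_rec l p F :
  lsum l.+1 p F = msum p (fun u v => lsum l v (fun c => F (sumn u :: c))).
Proof.
elim: p F => //= x p IHp F; rewrite big_ord_recl /= IHp; congr (_ + _).
under eq_bigr => i _ do rewrite IHp.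
by rewrite -msum_sum.
Qed.

Lemma addc_nseq l : addc (nseq l 0%N) (nseq l 0%N) = nseq l 0%N.
Proof. by rewrite /addc; elim: l => //= l ->. Qed.

(** A labelling of [p] is a pair of labellings of the two halves of any splitting, and the total
    sizes add. *)
Lemma lsum_msum l p (G : seq nat -> seq nat -> K) F :
  msum p G * lsum l p F =
  msum p (fun u v => G u v * lsum l u (fun c => lsum l v (fun d => F (addc c d)))).
Proof.
elim: p G F => [|x p IHp] G F; first by rewrite /= addc_nseq.
rewrite /= mulrDl !mulr_sumr; congr (_ + _).
  under eq_bigr => i _ do rewrite IHp.
  rewrite -msum_sum; apply: eq_msum => u v _; rewrite mulr_sumr.
  apply: eq_bigr => i _; congr (_ * _); apply: eq_lsum => c _ _.
  by apply: eq_lsum => d _ _; rewrite addat_addcl.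
under eq_bigr => i _ do rewrite IHp.
rewrite -msum_sum; apply: eq_msum => u v _.
rewrite lsum_sum mulr_sumr.
apply: eq_bigr => i _; congr (_ * _); apply: eq_lsum => c _ _.
by apply: eq_lsum => d _ _; rewrite addat_addcr.
Qed.

Lemma lsum_expand l n u H : (sumn u <= n)%N ->
  lsum l u H = \sum_(a : l.-tuple 'I_n.+1)
     lsum l u (fun c => (c == map (@nat_of_ord _) a)%:R) * H (map (@nat_of_ord _) a).
Proof.
move=> le_u; under eq_bigr => a _ do rewrite mulrC -lsumZ.
rewrite -lsum_sum; apply: eq_lsum => c sc ac.
have szc : size (map (@inord n) c) == l by rewrite size_map sc.
have cE : map (@nat_of_ord _) (Tuple szc) = c.
  rewrite /= -map_comp map_id_in // => y yc /=; rewrite inordK // ltnS.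
  by rewrite (leq_trans _ le_u) // (allP ac).
rewrite (bigD1 (Tuple szc)) //= -[X in c == X]/(map _ (Tuple szc)) cE eqxx mulr1.
rewrite big1 ?addr0 // => a na; case: eqP => [e|_]; last by rewrite mulr0.
by case/eqP: na; apply: val_inj; apply: (inj_map val_inj); rewrite -e -[in LHS]cE.
Qed.

(* The number of ways to distribute the parts of [p] over blocks of sizes [q];
   this is the value of the Young character [xi^q] on cycle type [p]. *)
Fixpoint young (q p : seq nat) : K :=
  if q is x :: q' then
    msum p (fun u v => (sumn u == x)%:R * 1 * ((sumn v == sumn q')%:R * young q' v))
  else (p == [::])%:R.

Lemma pinv_msum n m (phi psi : seq nat -> K) : pinv phi -> pinv psi ->
  pinv (fun p => msum p (fun u v =>
    (sumn u == n)%:R * phi u * ((sumn v == m)%:R * psi v))).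
Proof.
move=> phi_inv psi_inv p q; apply: msum_perm => u u' v v' uu' vv'.
by rewrite (phi_inv _ _ uu') (psi_inv _ _ vv') (perm_sumn uu') (perm_sumn vv').
Qed.

Lemma young_perm q : pinv (young q).
Proof.
elim: q => [|x q IHq] /=; last exact: (pinv_msum _ _ (phi := fun=> 1)).
by move=> p r pr; rewrite -size_eq0 -[r == _]size_eq0 (perm_size pr).
Qed.

Lemma msum_eq n m p (phi psi : seq nat -> K) : sumn p = (n + m)%N ->
  msum p (fun u v => (sumn u == n)%:R * phi u * ((sumn v == m)%:R * psi v)) =
  msum p (fun u v => (sumn u == n)%:R * phi u * psi v).
Proof.
move=> sp; apply: eq_msum => u v /perm_sumn; rewrite sumn_cat sp.
have [->|_] := eqVneq (sumn u) n; last by rewrite !mul0r.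
by move/addnI->; rewrite eqxx !mul1r.
Qed.

Lemma young_lsum q p : sumn p = sumn q ->
  young q p = lsum (size q) p (fun c => (c == q)%:R).
Proof.
elim: q p => [|x q IHq] p sp; first by case: p sp => //= x p _; rewrite big_ord0.
rewrite [size _]/= lsum_rec /=; apply: eq_msum => u v /perm_sumn.
rewrite sumn_cat sp /= => e; have [su|nsu] := eqVneq (sumn u) x; last first.
  rewrite !mul0r (@eq_lsum _ _ _ (fun _ => 0 * 0)) ?lsumZ ?mul0r // => c _ _.
  by rewrite eqseq_cons (negPf nsu).
rewrite !mul1r (IHq v); last by apply: (@addnI x); rewrite -e su.
rewrite (_ : _ == _) ?mul1r; last by rewrite -(eqn_add2l x) -e su.
by apply: eq_lsum => c _ _; rewrite eqseq_cons su eqxx.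
Qed.

End LabelledCycles.

(** * The map [c]: multiplicativity for inner products and the image of [Xit1 n] *)

Section SolomonMap.
Variables (K : fieldType) (char0 : [pchar K] =i pred0).
Variables (star bullet : KS K -> KS K -> KS K) (c : KS K -> KS K).
Hypotheses (Hstar : is_outer_D star) (Hbullet : is_outer_C bullet).
Hypothesis Hc : is_Solomon star bullet c.

Let sD := @Dall_subspace K.

Let c_lin : linear_on (@Dall K) c. Proof. by case: Hc. Qed.

Let c_star x y : Dall x -> Dall y -> c (star x y) = bullet (c x) (c y).
Proof. by case: Hc => _ _ + _ _; apply. Qed.

Let pinv1 : pinv (fun=> 1 : K). Proof. by []. Qed.

Lemma c_incr n : c (W n (fun w => (all negb w)%:R)) = T n (fun=> 1).
Proof.
case: Hc => _ _ _ c0 c1; case: n => [|n].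
  by rewrite -triv_char_T -c0 Xi_W //; congr (c _); apply: W_ext => w /size0nil->.
rewrite -triv_char_T -c1 // (@Xi_comp K n.+1); last by rewrite /composition /= addn0 eqxx.
by congr (c _); apply: W_ext => w sw; rewrite /= andbT take_oversize ?sw.
Qed.

Lemma c_star_W n m (f h : bitseq -> K) phi psi : pinv phi -> pinv psi ->
  c (W n f) = T n phi -> c (W m h) = T m psi ->
  c (W (n + m) (fun w => f (take n.-1 w) * h (drop n w))) =
  T (n + m) (fun p => msum p (fun u v => (sumn u == n)%:R * phi u * psi v)).
Proof.
move=> phi_inv psi_inv cf ch; rewrite -(star_W Hstar) c_star; try exact: Dall_W.
rewrite cf ch (bullet_T char0 Hbullet) //; apply: T_ext => p _ sp.
exact: msum_eq.
Qed.

(** Induction on the number of labels: [Y_rec] splits off an increasing block, sent by [c] to a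
    trivial character, and the outer product becomes the splitting in [lsum_rec]. *)
Lemma c_Y l x F : c (W x (Y l x F)) = T x (fun p => lsum l p F).
Proof.
elim: l x F => [|l IHl] x F.
  case: x => [|x].
    have -> : W 0 (Y 0 0 F) = F [::] *: W 0 (fun w => (all negb w)%:R).
      rewrite -WZ; apply: W_ext => w /size0nil->.
      by rewrite /Y /= mulr1.
    rewrite (linear_onZ sD c_lin) ?c_incr; last exact: Dall_W.
    by rewrite -TZ; apply: T_ext => -[|x p] //=; rewrite ?mulr1 // => /andP[]; case: x.
  have -> : W x.+1 (Y 0 x.+1 F) = 0.
    by rewrite -(W0 K x.+1); apply: W_ext => w _; rewrite /Y /= big_ord0.
  rewrite (linear_on0 sD c_lin) -(T0 K x.+1); apply: T_ext => -[|y p] //= _ _.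
  by rewrite big_ord0.
have -> : W x (Y l.+1 x F) = \sum_(a < x.+1) W x (fun w =>
    (all negb (take a.-1 w))%:R * Y l (x - a) (fun b => F ((a : nat) :: b)) (drop a w)).
  by rewrite -W_sum; apply: W_ext => w sw; apply: Y_rec.
rewrite (linear_on_sum sD c_lin) => [|a _]; last exact: Dall_W.
transitivity (\sum_(a < x.+1) T x (fun p => msum p (fun u v =>
    (sumn u == a)%:R * lsum l v (fun b => F ((a : nat) :: b))))).
  apply: eq_bigr => a _; have le_a : (a <= x)%N by rewrite -ltnS.
  have := c_star_W pinv1 (@lsum_perm K l (fun b => F ((a : nat) :: b))) (c_incr a) (IHl (x - a)%N _).
  rewrite subnKC // => ->; apply: T_ext => p _ _; apply: eq_msum => u v _.
  by rewrite mulr1.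
rewrite -T_sum; apply: T_ext => p _ sp; rewrite lsum_rec -msum_sum.
apply: eq_msum => u v /perm_sumn; rewrite sumn_cat sp => e.
have lt_u : (sumn u < x.+1)%N by rewrite ltnS -e leq_addr.
rewrite (bigD1 (Ordinal lt_u)) //= eqxx mul1r big1 ?addr0 // => a.
by rewrite -(inj_eq val_inj) eq_sym /= => /negPf->; rewrite mul0r.
Qed.

Lemma c_incl q : posword q ->
  c (W (sumn q) (fun w => (inclb w q)%:R)) = T (sumn q) (young K q).
Proof.
elim: q => [_|x q IHq /andP[_ pos_q]].
  transitivity (c (W 0 (fun w => (all negb w)%:R : K))).
    by congr (c _); apply: W_ext => w /size0nil->.
  rewrite c_incr; apply: T_ext => -[|x p] //= /andP[].
  by case: x.
have -> : W (sumn (x :: q)) (fun w => (inclb w (x :: q))%:R) =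
    W (x + sumn q) (fun w => (all negb (take x.-1 w))%:R * (inclb (drop x w) q)%:R : K).
  by apply: W_ext => w _; rewrite -natrM mulnb.
have := c_star_W pinv1 (@young_perm K q) (c_incr x) (IHq pos_q).
move=> ->; apply: T_ext => p _ sp /=.
by rewrite -(msum_eq (fun=> 1) _ sp).
Qed.

Lemma c_Xi n q : composition n q -> c (Xi K q) = T n (young K q).
Proof. by case/andP=> pos_q /eqP <-; rewrite Xi_W // c_incl. Qed.

Lemma c_B l q F : posword q ->
  c (W (sumn q) (B l q F)) = T (sumn q) (fun p => young K q p * lsum l p F).
Proof.
elim: q F => [F _|x q IHq F /andP[x_gt0 pos_q]].
  have -> : W 0 (B l [::] F) = F (nseq l 0%N) *: W 0 (fun w => (all negb w)%:R).
    rewrite -WZ; apply: W_ext => w /size0nil->; rewrite /B /= !mulr1.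
    congr F; apply: (@eq_from_nth _ 0%N); rewrite size_mkseq ?size_nseq // => i lt_i.
    by rewrite nth_mkseq // nth_nseq if_same.
  rewrite (linear_onZ sD c_lin) ?c_incr; last exact: Dall_W.
  rewrite -TZ; apply: T_ext => -[|y p] //=; first by rewrite mulr1 mul1r.
  by case: y.
have -> : W (sumn (x :: q)) (B l (x :: q) F) = \sum_(a : l.-tuple 'I_x.+1)
    W (x + sumn q) (fun w =>
      Y l x (fun b => (b == map (@nat_of_ord _) a)%:R) (take x.-1 w) *
      B l q (fun b => F (addc (map (@nat_of_ord _) a) b)) (drop x w)).
  by rewrite -W_sum; apply: W_ext => w sw; apply: B_cons.
rewrite (linear_on_sum sD c_lin) => [|a _]; last exact: Dall_W.
under eq_bigr => a _.
  rewrite (c_star_W (@lsum_perm K l _) _ (c_Y _ _ _) (IHq _ pos_q)); last first.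
    move=> p r pr; congr (_ * _); first exact: young_perm.
    exact: (@lsum_perm K l _ _ _ pr).
  over.
rewrite -T_sum; apply: T_ext => p _ sp; rewrite -msum_sum /=.
(* The labelling is divided between [u] and [v]. As [u] has sum [x], its label totals are at most
   [x], and [lsum_expand] produces the same sum over [a]. *)
rewrite (msum_eq (fun=> 1) _ sp) lsum_msum; apply: eq_msum => u v _.
have [su|_] := eqVneq (sumn u) x; last by rewrite !mul0r big1 // => a _; rewrite !mul0r.
rewrite !mul1r (@lsum_expand _ l x u) ?su // mulr_sumr; apply: eq_bigr => a _.
by rewrite mul1r mulrCA.
Qed.

(** With the indicator of [r] for [F], the second factor in [c_B] is the Young character of [r], by
    [young_lsum]. *)
Lemma c_inner_Xi q r : posword q -> posword r ->
  c (inner_perm (Xi K q) (Xi K r)) = inner_class (c (Xi K q)) (c (Xi K r)).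
Proof.
move=> pos_q pos_r; have [e|ne] := eqVneq (sumn q) (sumn r); last first.
  rewrite !Xi_W // inner_perm_fun_elt_neq // (linear_on0 sD c_lin).
  by rewrite !c_incl // inner_T_neq.
have comp_q : composition (sumn q) q by rewrite /composition pos_q eqxx.
have comp_r : composition (sumn q) r by rewrite /composition pos_r e eqxx.
rewrite (Xi_inner_Xi _ comp_q comp_r) c_B // (c_Xi comp_q) (c_Xi comp_r) inner_T.
by apply: T_ext => p _ sp; rewrite [young K r p]young_lsum // -e.
Qed.

Lemma Dall_inner (x y : KS K) : Dall x -> Dall y -> Dall (inner_perm x y).
Proof.
have bil := @inner_perm_bilinear K (@Dall K); move=> /Dall_span Gx /Dall_span Gy.
apply: (bilinear_on_lspan sD bil sD _ _ _ Gx Gy).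
- by move=> _ [q ? ->]; apply: Dall_Xi.
- by move=> _ [q ? ->]; apply: Dall_Xi.
move=> _ _ [q pos_q ->] [r pos_r ->].
have [e|ne] := eqVneq (sumn q) (sumn r); last first.
  by rewrite !Xi_W // inner_perm_fun_elt_neq //; case: sD.
have comp_q : composition (sumn q) q by rewrite /composition pos_q eqxx.
have comp_r : composition (sumn q) r by rewrite /composition pos_r e eqxx.
by rewrite (Xi_inner_Xi _ comp_q comp_r); apply: Dall_W.
Qed.

Lemma c_inner (x y : KS K) : Dall x -> Dall y ->
  c (inner_perm x y) = inner_class (c x) (c y).
Proof.
have [permr perml] := @inner_perm_bilinear K (@Dall K).
have [classr classl] := @inner_class_bilinear K (fun=> True).
have linr u : Dall u -> linear_on (@Dall K) (fun v => c (inner_perm u v)).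
  by move=> Du a v w Dv Dw; rewrite permr // c_lin //; apply: Dall_inner.
have linl v : Dall v -> linear_on (@Dall K) (fun u => c (inner_perm u v)).
  move=> Dv a u w Du Dw; rewrite -c_lin; try exact: Dall_inner.
  by congr (c _); exact: perml.
have linr' u : linear_on (@Dall K) (fun v => inner_class u (c v)).
  by move=> a v w Dv Dw; rewrite c_lin // classr.
have linl' v : linear_on (@Dall K) (fun u => inner_class (c u) v).
  by move=> a u w Du Dw; rewrite c_lin //; exact: classl.
move=> Dx Dy; apply: (linear_on_eq sD (linl y Dy) (linl' (c y)) _ (Dall_span Dx)).
move=> _ [q pos_q ->]; have Dq := Dall_Xi K pos_q; split=> //.
apply: (linear_on_eq sD (linr _ Dq) (linr' _) _ (Dall_span Dy)).
by move=> _ [r pos_r ->]; split; [apply: Dall_Xi | apply: c_inner_Xi].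
Qed.

Definition theta_class (p : seq nat) : K := \prod_(x <- p) (if odd x then 2 else 0).

Lemma theta_class_perm : pinv theta_class.
Proof. by move=> p q; apply: perm_big. Qed.

Lemma theta_classE p : theta_class p = (oddword p)%:R * 2 ^+ size p.
Proof.
rewrite /theta_class; elim: p => [|x p IHp]; first by rewrite big_nil mulr1.
rewrite big_cons IHp /=; case: odd => /=; last by rewrite !mul0r.
by rewrite exprS mulrCA.
Qed.

(** The sum factors over the parts x of [p], each giving (-1)^x plus its factor in [theta_class],
    which is 1 for either parity. *)
Lemma msum_sign_theta p :
  msum p (fun u v => (-1) ^+ sumn u * theta_class v) = 1.
Proof.
elim: p => [|x p IHp] /=; first by rewrite /theta_class big_nil mulr1.
under eq_msum => u v _ do rewrite exprD -mulrA.
rewrite msumZ IHp mulr1 [X in _ + X](_ : _ = if odd x then 2 else 0).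
  by rewrite -signr_odd; case: odd; rewrite /= ?expr1 ?expr0; ring.
rewrite -[RHS]mulr1 -[X in _ = _ * X]IHp -msumZ; apply: eq_msum => u v _.
by rewrite /theta_class big_cons mulrCA.
Qed.

Lemma msum_sum0 p (G : seq nat -> seq nat -> K) : posword p ->
  msum p (fun u v => (sumn u == 0%N)%:R * G u v) = G [::] p.
Proof.
elim: p G => [|x p IHp] G /=; first by rewrite mul1r.
case/andP=> x_gt0 pos_p; rewrite (IHp (fun u v => G u (x :: v))) //.
rewrite (@eq_msum _ _ _ (fun _ _ => 0 * 0)) ?msumZ ?mul0r ?add0r // => u v _.
by rewrite addn_eq0 (gtn_eqF x_gt0) /= !mul0r.
Qed.

Lemma incr_theta n w : size w = n.-1 ->
  \sum_(k < n.+1) (-1) ^+ k *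
     ((all negb (take k.-1 w))%:R * theta1 K (n - k) (drop k w)) = (all negb w)%:R.
Proof.
case: n => [|m] sw.
  by rewrite big_ord_recl big_ord0 (size0nil sw) /= !mul1r addr0.
(* The terms k = 0 (empty first factor) and k = n (where [theta1] is 1, without the factor 2) are
   special; the rest is -2 times the sum in [sum_incr_valley]. *)
rewrite big_ord_recl big_ord_recr /= /bump /= !add1n subnn take0 drop0 !mul1r ?subn0.
rewrite [X in _ + (X + _)](_ : _ = - (2 * \sum_(k < size w)
    (-1) ^+ k * ((all negb (take k w))%:R * (valley (drop k.+1 w))%:R))); last first.
  rewrite mulr_sumr -sumrN [in RHS]sw; apply: eq_bigr => k _.
  rewrite !add1n subSS -(@prednK (m - k)) ?subn_gt0 //= exprS.
  by ring.
rewrite sum_incr_valley sw take_oversize ?sw // exprS -signr_odd.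
by case: odd; rewrite /= ?expr0 ?expr1; ring.
Qed.

(** Solving [incr_theta] for its term k = 0 expresses [Xit1 n] through lower degrees, and
    [msum_sign_theta] is the same relation for [theta_class]. *)
Lemma c_Xit1 n : c (Xit1 K n) = T n theta_class.
Proof.
have [m] := ubnP n; elim: m n => // m IHm n le_n; rewrite ltnS in le_n.
have e0 : W n (fun w => (all negb w)%:R : K) = Xit1 K n + \sum_(k < n)
    (-1) ^+ k.+1 *: W n (fun w => (all negb (take k.+1.-1 w))%:R
                           * theta1 K (n - k.+1) (drop k.+1 w)).
  rewrite Xit1_W; under eq_bigr => k _ do rewrite -WZ.
  rewrite -W_sum -WD; apply: W_ext => w sw; rewrite -(incr_theta sw) big_ord_recl.
  by rewrite /= take0 drop0 subn0 !mul1r.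
have DW k (f : bitseq -> K) : Dall (W k f) := @Dall_W K k f.
have DZ a k (f : bitseq -> K) : Dall (a *: W k f) := subspaceZ a sD (DW k f).
have -> : Xit1 K n = W n (fun w => (all negb w)%:R : K) - \sum_(k < n)
    (-1) ^+ k.+1 *: W n (fun w => (all negb (take k.+1.-1 w))%:R
                           * theta1 K (n - k.+1) (drop k.+1 w)).
  by rewrite e0 addrK.
have Ds : Dall (\sum_(k < n) (-1) ^+ k.+1 *: W n (fun w =>
    (all negb (take k.+1.-1 w))%:R * theta1 K (n - k.+1) (drop k.+1 w))).
  by apply: subspace_sum => // k _; apply: DZ.
rewrite (linear_onB c_lin (DW _ _) Ds) c_incr (linear_on_sum sD c_lin) => [|k _]; last exact: DZ.
transitivity (T n (fun=> 1) - \sum_(k < n) (-1) ^+ k.+1 *: T n (fun p =>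
    msum p (fun u v => (sumn u == k.+1)%:R * theta_class v))).
  congr (_ - _); apply: eq_bigr => k _; rewrite (linear_onZ sD c_lin _ (DW _ _)).
  congr (_ *: _); have lt_k := ltn_ord k.
  have cX : c (W (n - k.+1) (theta1 K (n - k.+1))) = T (n - k.+1) theta_class.
    by rewrite -Xit1_W IHm //; apply: leq_trans le_n; rewrite -subn_gt0 subKn // ltn_subrL.
  have := c_star_W pinv1 theta_class_perm (c_incr k.+1) cX.
  rewrite subnKC // => ->; apply: T_ext => p _ _; apply: eq_msum => u v _.
  by rewrite mulr1.
under eq_bigr => k _ do rewrite -TZ.
rewrite -T_sum -scaleN1r addrC -T_lin; apply: T_ext => p pos_p sp.
rewrite -(msum_sum0 (fun u v => theta_class v) pos_p).
have E : \sum_(k < n.+1) (-1) ^+ k *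
    msum p (fun u v => (sumn u == k)%:R * theta_class v) = 1.
  under eq_bigr => k _ do rewrite -msumZ.
  rewrite -msum_sum -[RHS](msum_sign_theta p); apply: eq_msum => u v /perm_sumn.
  rewrite sumn_cat sp => e; have lt_u : (sumn u < n.+1)%N by rewrite ltnS -e leq_addr.
  rewrite (bigD1 (Ordinal lt_u)) //= eqxx mul1r big1 ?addr0 // => a.
  by rewrite -(inj_eq val_inj) eq_sym /= => /negPf->; rewrite mul0r mulr0.
rewrite mulN1r addrC; apply/eqP; rewrite subr_eq; apply/eqP.
by rewrite -[LHS]E big_ord_recl /= expr0 mul1r.
Qed.

End SolomonMap.

(** * A permutation with prescribed cycles *)

Section PermutationOfCycleType.
Variables (n : nat) (cs : seq (seq 'I_n)).
Hypotheses (cs_uniq : uniq (flatten cs)) (cs_all : forall x, x \in flatten cs).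
Hypothesis cs_n0 : [::] \notin cs.

Let blk x := nth [::] cs (find (fun d => x \in d) cs).

Let has_blk x : has (fun d : seq 'I_n => x \in d) cs.
Proof. by have /flattenP[d dcs xd] := cs_all x; apply/hasP; exists d. Qed.

Let blk_mem x : x \in blk x. Proof. exact: (nth_find [::] (has_blk x)). Qed.

Let blk_in x : blk x \in cs. Proof. by rewrite mem_nth // -has_find has_blk. Qed.

Let blk_uniq d x : d \in cs -> x \in d -> blk x = d.
Proof.
move=> dcs xd; have := blk_in x; have := blk_mem x; move: (blk x) => e xe ecs.
move: dcs ecs cs_uniq; elim: cs => //= b bs IHbs; rewrite !inE cat_uniq.
move=> dcs ecs /and3P[_ /hasPn dis ubs].
have notin f : f \in bs -> x \in f -> x \notin b.
  by move=> fbs xf; apply: dis; apply/flattenP; exists f.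
case/orP: dcs => [/eqP eb|dbs]; case/orP: ecs => [/eqP eb'|ebs].
- by rewrite eb eb'.
- by have := notin e ebs xe; rewrite -eb xd.
- by have := notin d dbs xd; rewrite -eb' xe.
- exact: IHbs.
Qed.

Let uniq_in d : d \in cs -> uniq d.
Proof.
move: cs_uniq; elim: cs => //= b bs IHbs; rewrite cat_uniq => /and3P[ub _ ubs].
by rewrite inE => /orP[/eqP->|/IHbs->].
Qed.

Let cs_uniq' : uniq cs.
Proof.
move: cs_uniq cs_n0; elim: cs => //= b bs IHbs; rewrite cat_uniq inE negb_or.
move=> /and3P[_ /hasPn dis ubs] /andP[b0 bs0]; rewrite IHbs // andbT.
apply/negP => bbs; case: b b0 dis bbs => // x b _ dis bbs.
have := dis x; rewrite mem_head; move=> /(_ _)/negP; case=> //.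
by apply/flattenP; exists (x :: b); rewrite ?mem_head.
Qed.

Let step x := next (blk x) x.

Let blk_step x : blk (step x) = blk x.
Proof. by apply: blk_uniq; rewrite ?blk_in // mem_next blk_mem. Qed.

Let step_inj : injective step.
Proof.
move=> x y e; have eb : blk x = blk y by rewrite -blk_step e blk_step.
have := prev_next (uniq_in (blk_in x)) x; rewrite -/(step x) e eb.
by rewrite prev_next // uniq_in // blk_in.
Qed.

Lemma cycle_type_exists : exists s : 'S_n, perm_eq (cycle_type s) (shape cs).
Proof.
exists (perm step_inj); set s := perm _.
have sE x : s x = step x by rewrite permE.
have orb x : porbit s x = [set y in blk x].
  have fc : fcycle s (blk x).
    apply: (sub_in_cycle (P := mem (blk x)) (e := frel (next (blk x)))).
    - move=> y z yb _ /= /eqP <-; rewrite sE /step.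
      by rewrite (blk_uniq (blk_in x) yb).
    - exact/allP.
    - exact: cycle_next (uniq_in (blk_in x)).
  apply/setP => y; rewrite inE -(fconnect_cycle fc (blk_mem x)).
  apply/porbitP/idP => [[i ->]|/iter_findex <-].
    by rewrite permX fconnect_iter.
  by exists (findex s x y); rewrite permX.
have e : perm_eq (enum (porbits s)) [seq [set y in (d : seq 'I_n)] | d <- cs].
  apply: uniq_perm; first exact: enum_uniq.
    rewrite map_inj_in_uniq // => d d' dcs d'cs /setP e.
    case: d dcs e => [d0|x d dcs /(_ x)]; first by case/negP: cs_n0.
    rewrite !inE eqxx /= => /esym xd'.
    by rewrite -(blk_uniq d'cs xd') (blk_uniq dcs) ?mem_head.
  move=> b; rewrite mem_enum; apply/imsetP/mapP => [[x _ ->]|[d dcs ->]].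
    by exists (blk x); rewrite ?blk_in // orb.
  case: d dcs => [d0|x d dcs]; first by case/negP: cs_n0.
  by exists x => //; rewrite orb (blk_uniq dcs) // mem_head.
rewrite /cycle_type (perm_trans (perm_map _ e)) // -map_comp.
rewrite (_ : map _ _ = shape cs) //; apply/eq_in_map => d dcs /=.
by rewrite cardsE; apply/card_uniqP/uniq_in.
Qed.

End PermutationOfCycleType.

(** Provides a point where [char K q] does not vanish, needed to extract coefficients in
    [Xit_partition_free]. The cycles are consecutive blocks of lengths [q]. *)
Lemma exists_cycle_type q : posword q ->
  exists s : 'S_(sumn q), perm_eq (cycle_type s) q.
Proof.
move=> pos_q; pose cs := reshape q (enum 'I_(sumn q)).
have fl : flatten cs = enum 'I_(sumn q) by rewrite reshapeKr // size_enum_ord.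
have sh : shape cs = q by rewrite reshapeKl // size_enum_ord.
suff : exists s : 'S_(sumn q), perm_eq (cycle_type s) (shape cs) by rewrite sh.
apply: cycle_type_exists.
- by rewrite fl enum_uniq.
- by move=> x; rewrite fl mem_enum.
apply/negP => nil_cs; have : 0%N \in q by rewrite -sh; apply/mapP; exists [::].
by move/allP: pos_q => H /H.
Qed.

(** * Triangularity of [c] on the [Xit q]: surjectivity, kernel and inner closure *)

Section Triangularity.
Variables (K : fieldType) (char0 : [pchar K] =i pred0).
Variables (star bullet : KS K -> KS K -> KS K) (c : KS K -> KS K).
Hypotheses (Hstar : is_outer_D star) (Hbullet : is_outer_C bullet).
Hypothesis Hc : is_Solomon star bullet c.

Let sD := @Dall_subspace K.
Let sC := @Call_subspace K.

Let c_lin : linear_on (@Dall K) c. Proof. by case: Hc. Qed.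

(** A filtration of the odd class functions by number of parts, multiplicative for [bullet] by
    [long_bullet]. *)
Definition long n k := lspan (fun x =>
  exists q, [/\ odd_composition n q, (k <= size q)%N & x = ch K q]).

Let long_subspace n k : subspace (long n k) := lspan_subspace _.

Lemma long_ch n q k : odd_composition n q -> (k <= size q)%N -> long n k (ch K q).
Proof. by move=> oq kq; apply: lspan_gen; exists q. Qed.

Lemma long_Codd n k (x : KS K) : long n k x -> Codd x.
Proof.
apply: lspan_min; first exact: Codd_subspace.
move=> _ [q [/andP[oq _] _ ->]]; apply: subspaceZ; first exact: Codd_subspace.
by apply: lspan_gen; exists q.
Qed.

Lemma long_Call n k (x : KS K) : long n k x -> Call x.
Proof. by move/long_Codd/Codd_Call. Qed.

Lemma long_le n k l x : (k <= l)%N -> long n l x -> long n k x.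
Proof.
move=> kl; apply: lspan_min; first exact: long_subspace.
by move=> _ [q [oq lq ->]]; apply: long_ch => //; apply: leq_trans lq.
Qed.

Lemma long_bullet n m k l x y :
  long n k x -> long m l y -> long (n + m) (k + l) (bullet x y).
Proof.
have [bil bullet_ch] := Hbullet.
apply: (bilinear_on_lspan sC bil (long_subspace _ _)).
- by move=> _ [q [_ _ ->]]; apply: Call_ch.
- by move=> _ [q [_ _ ->]]; apply: Call_ch.
move=> _ _ [q [oq kq ->]] [r [or lr ->]].
have /andP[pos_q _] := odd_composition_comp oq.
have /andP[pos_r _] := odd_composition_comp or.
rewrite bullet_ch //; apply: long_ch; first exact: odd_composition_cat.
by rewrite size_cat leq_add.
Qed.

(** For each part x, 2 is the value of [theta_class] on a single odd cycle, and 1/x converts [char]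
    of that cycle into [ch]. *)
Definition lead (q : seq nat) : K := \prod_(x <- q) (2 / x%:R).

Lemma lead_neq0 q : posword q -> lead q != 0.
Proof.
elim: q => [|x q IHq] /=; first by rewrite /lead big_nil oner_eq0.
case/andP=> x_gt0 /IHq; rewrite /lead big_cons => q0.
by rewrite mulf_neq0 // mulf_neq0 ?invr_eq0 // natr_neq0.
Qed.

Lemma c_Xit1_lead x : odd x -> long x 2 (c (Xit1 K x) - (2 / x%:R) *: ch K [:: x]).
Proof.
move=> odd_x; have x_gt0 : (0 < x)%N by case: x odd_x.
have pos_x : posword [:: x] by rewrite /= x_gt0.
have -> : (2 / x%:R) *: ch K [:: x] = 2 *: char K [:: x].
  have zx : qfact [:: x] = x by rewrite qfact_cons // /qfact big_geq // muln1 mul1n.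
  by rewrite /ch scalerA zx divfK ?natr_neq0.
rewrite (c_Xit1 char0 Hstar Hbullet Hc) char_T /= addn0 -scaleNr addrC -T_lin.
rewrite T_char_sum; last first.
  by move=> p q pq; rewrite (@theta_class_perm K _ _ pq) (permPl pq).
apply: subspace_sum => // p /andP[_ /andP[pos_p /eqP sum_p]].
move: [seq val i | i <- p] pos_p sum_p => {}p pos_p sum_p.
have [p1|np1] := eqVneq p [:: x].
  rewrite p1 perm_refl theta_classE /= odd_x expr1 mul1r mulr1 addNr scale0r.
  by have [] := long_subspace x 2.
rewrite (_ : perm_eq p _ = false); last first.
  by apply: contraNF np1 => e; apply/eqP/perm_small_eq.
rewrite mulr0 add0r theta_classE; case: (boolP (oddword p)) => [odd_p|_]; last first.
  by rewrite mul0r scale0r; have [] := long_subspace x 2.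
rewrite (char_ch char0 pos_p) scalerA; apply: subspaceZ => //.
apply: long_ch; first by rewrite /odd_composition odd_p sum_p eqxx.
case: p np1 sum_p {pos_p odd_p} => [|y [|z p]] //=; first by move=> _ x0; rewrite -x0 in x_gt0.
by move=> + y0; rewrite -y0 addn0 eqxx.
Qed.

Lemma long_bullet_lead n m k l a b a0 b0 : long n k a0 -> long m l b0 ->
  long n k.+1 (a - a0) -> long m l.+1 (b - b0) ->
  long (n + m) (k + l).+1 (bullet a b - bullet a0 b0).
Proof.
move=> La0 Lb0 La Lb; have [[linr linl] _] := Hbullet.
have Lb' : long m l b.
  rewrite -(subrK b0 b); apply: (subspaceD (long_subspace m l) _ Lb0).
  exact: long_le (leqnSn l) Lb.
have La' : long n k a.
  rewrite -(subrK a0 a); apply: (subspaceD (long_subspace n k) _ La0).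
  exact: long_le (leqnSn k) La.
have -> : bullet a b - bullet a0 b0 = bullet (a - a0) b + bullet a0 (b - b0).
  rewrite (linear_onB (linl _ (long_Call Lb')) (long_Call La') (long_Call La0)).
  rewrite (linear_onB (linr _ (long_Call La0)) (long_Call Lb') (long_Call Lb0)).
  by rewrite addrA subrK.
apply: (subspaceD (long_subspace _ _)); first exact: (long_bullet La Lb').
by rewrite -addnS; exact: (long_bullet La0 Lb).
Qed.

Lemma c_Xit_lead n q : odd_composition n q ->
  long n (size q).+1 (c (Xit star q) - lead q *: ch K q).
Proof.
have [bil bullet_ch] := Hbullet; have [linr linl] := bil.
have [_ _ c_star c0 _] := Hc.
elim: q n => [|x q IHq] n /andP[].
  move=> _ /eqP <-; have [long0 _] := long_subspace 0 1.
  rewrite /lead big_nil scale1r [Xit _ _]/= c0 (_ : _ - _ = 0) //.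
  apply/eqP; rewrite subr_eq0; apply/eqP.
  rewrite /ch /qfact big_geq // scale1r char_T triv_char_T.
  apply: T_ext => -[|y p] // /andP[y_gt0 _] /= /eqP.
  by rewrite addn_eq0 (gtn_eqF y_gt0).
move=> /= /andP[odd_x odd_q] /eqP <-.
have oq : odd_composition (sumn q) q by rewrite /odd_composition odd_q eqxx.
have ox : odd_composition x [:: x] by rewrite /odd_composition /= odd_x addn0 eqxx.
have /andP[pos_q _] := odd_composition_comp oq.
have x_gt0 : (0 < x)%N by case: x odd_x {ox}.
have Dx : Dall (Xit1 K x) by rewrite Xit1_W; apply: Dall_W.
rewrite -[Xit star (x :: q)]/(star (Xit1 K x) (Xit star q)).
rewrite (c_star _ _ Dx (Dall_Xit Hstar q)).
have -> : lead (x :: q) *: ch K (x :: q) =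
    bullet ((2 / x%:R) *: ch K [:: x]) (lead q *: ch K q).
  have Cb : Call (lead q *: ch K q) by exact: (subspaceZ _ sC (Call_ch K _)).
  rewrite (linear_onZ sC (linl _ Cb) _ (Call_ch K _)).
  rewrite (linear_onZ sC (linr _ (Call_ch K _)) _ (Call_ch K _)) scalerA.
  by rewrite bullet_ch //= ?x_gt0 // /lead big_cons.
rewrite -add1n; apply: (@long_bullet_lead x (sumn q) 1 (size q)).
- by apply: (subspaceZ _ (long_subspace _ _)); apply: long_ch.
- by apply: (subspaceZ _ (long_subspace _ _)); apply: long_ch.
- exact: c_Xit1_lead.
- exact: IHq oq.
Qed.

Lemma c_Pall_Codd (x : KS K) : Pall x -> Codd (c x).
Proof.
move/(PallP char0 Hstar); apply: (linear_on_image_lspan sD c_lin (@Codd_subspace K)).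
move=> _ [q oq ->]; split; first exact: Dall_Xit.
have oq' : odd_composition (sumn q) q by rewrite /odd_composition oq eqxx.
rewrite -(subrK (lead q *: ch K q) (c _)); apply: (subspaceD (@Codd_subspace K)).
  exact: long_Codd (c_Xit_lead oq').
by apply: (@long_Codd (sumn q) 0); apply: subspaceZ => //; apply: long_ch.
Qed.

Lemma Codd_onto (y : KS K) : Codd y -> exists2 x, Pall x & c x = y.
Proof.
have sP := @Pall_subspace K.
have sI : subspace (fun y => exists2 x, Pall x & c x = y).
  have [P0 Pl] := sP; split=> [|a _ _ [x Px <-] [x' Px' <-]].
    by exists 0 => //; apply: linear_on0 sD c_lin.
  exists (a *: x + x'); first exact: Pl.
  by apply: c_lin; apply: Pall_Dall Hstar _ _.
(* Solving [c_Xit_lead] for [ch K q] leaves terms with more parts. A composition of [n] has at most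
   [n] parts, so induction on [n - size q] terminates. *)
have onto_ch k n q : (n - size q < k)%N -> odd_composition n q ->
    exists2 x, Pall x & c x = ch K q.
  elim: k q => // k IHk q le_k oq.
  have [pos_q /eqP sum_q] := andP (odd_composition_comp oq).
  have -> : ch K q = (lead q)^-1 *: (c (Xit star q) - (c (Xit star q) - lead q *: ch K q)).
    by rewrite opprB addrC subrK scalerA mulVf ?scale1r // lead_neq0.
  apply: (subspaceZ _ sI); apply: (subspaceB sI).
    exists (Xit star q) => //; apply/(PallP char0 Hstar)/lspan_gen; exists q => //.
    by case/andP: oq.
  apply: (lspan_min sI _ (c_Xit_lead oq)) => _ [r [or lt_r ->]].
  apply: IHk (or); have /andP[pos_r /eqP sum_r] := odd_composition_comp or.
  by have := leq_size_sumn pos_r; rewrite sum_r; lia.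
apply: (lspan_min sI) => _ [q oq ->].
have oq' : odd_composition (sumn q) q by rewrite /odd_composition oq eqxx.
have /andP[pos_q _] := odd_composition_comp oq'.
by rewrite (char_ch char0 pos_q); apply: (subspaceZ _ sI); apply: onto_ch oq'.
Qed.

Lemma msum_flip p (G : seq nat -> seq nat -> K) : msum p G = msum p (fun u v => G v u).
Proof. by elim: p G => //= x p IHp G; rewrite addrC IHp [X in _ + X]IHp. Qed.

(** Commutativity of [bullet] is not among the hypotheses; for a swap of two letters it is read off
    from [bullet_T], whose sum over splittings is symmetric. *)
Lemma c_Xit_perm q q' : posword q -> perm_eq q q' -> c (Xit star q) = c (Xit star q').
Proof.
have [_ _ c_star _ _] := Hc.
have DX := Dall_Xit Hstar.
have c_cat r s : posword r ->
    c (Xit star (r ++ s)) = bullet (c (Xit star r)) (c (Xit star s)).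
  by move=> pos_r; rewrite -(Xit_cat Hstar) // c_star.
pose R q q' := posword q -> posword q' /\ c (Xit star q) = c (Xit star q').
move=> pos_q qq'; suff [] : posword q' /\ c (Xit star q) = c (Xit star q') by [].
move: qq' pos_q; apply: (perm_eq_rel_ind (R := R)) => {q q'}.
- by [].
- move=> x p q Rpq /= /andP[x_gt0 pos_p]; have [pos_q e] := Rpq pos_p.
  split; first exact/andP.
  by rewrite -[x :: p]cat1s -[x :: q]cat1s !c_cat /= ?x_gt0 // e.
- move=> x y p /= /and3P[x_gt0 y_gt0 pos_p]; split; first exact/and3P.
  rewrite -[[:: x, y & p]]/([:: x; y] ++ p) -[[:: y, x & p]]/([:: y; x] ++ p).
  rewrite !c_cat /= ?x_gt0 ?y_gt0 //; congr (bullet _ _).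
  rewrite -[[:: x; y]]cat1s -[[:: y; x]]cat1s !c_cat /= ?x_gt0 ?y_gt0 // !Xit_seq1 //.
  rewrite !(c_Xit1 char0 Hstar Hbullet Hc) !(bullet_T char0 Hbullet) //;
    try exact: theta_class_perm.
  rewrite addnC; apply: T_ext => r _ _; rewrite msum_flip.
  by apply: eq_msum => u v _; rewrite mulrC.
- move=> p q r Rpq Rqr pos_p; have [pos_q e] := Rpq pos_p.
  by have [pos_r e'] := Rqr pos_q; rewrite e e'.
Qed.

Definition rearrangements n (y : KS K) : Prop := exists q q' : seq nat,
  [/\ odd_composition n q, odd_composition n q', perm_eq q q'
    & y = Xit star q - Xit star q'].

Lemma rearrangements_ker n (x : KS K) :
  lspan (rearrangements n) x -> Pn n x /\ c x = 0.
Proof.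
have sPn := @Pn_subspace K n; move=> Ix.
have Xt q : odd_composition n q -> Pn n (Xit star q).
  by move/odd_composition_comp; apply: Pn_Xit.
have s0 : subspace (fun y : KS K => y = 0).
  by split=> // a _ _ -> ->; rewrite scaler0 addr0.
split; first apply: (lspan_min sPn _ Ix) => _ [q [q' [oq oq' _ ->]]].
  by apply: subspaceB => //; apply: Xt.
apply: (linear_on_image_lspan sD c_lin s0 _ Ix) => _ [q [q' [oq oq' qq' ->]]].
have DX := Dall_Xit Hstar; split; first exact: subspaceB sD (DX q) (DX q').
rewrite (linear_onB c_lin (DX q) (DX q')) (@c_Xit_perm q q') ?subrr //.
by case/andP: (odd_composition_comp oq).
Qed.

(** Modulo the relations each odd [q] may be sorted, so partitions suffice as indices. *)
Lemma Pn_mod_rearrangements n (x : KS K) : Pn n x ->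
  exists b : n.-bseq 'I_n.+1 -> K,
    lspan (rearrangements n) (x - \sum_(p : n.-bseq 'I_n.+1 |
       odd_partition n [seq val i | i <- p]) b p *: Xit star [seq val i | i <- p]).
Proof.
pose S x := exists b : n.-bseq 'I_n.+1 -> K,
    lspan (rearrangements n) (x - \sum_(p : n.-bseq 'I_n.+1 |
       odd_partition n [seq val i | i <- p]) b p *: Xit star [seq val i | i <- p]).
have sI := lspan_subspace (rearrangements n); have [I0 Il] := sI.
have sS : subspace S.
  split=> [|a y z [b Ib] [d Id]].
    by exists (fun=> 0); rewrite big1 ?subrr // => p _; rewrite scale0r.
  exists (fun p => a * b p + d p).
  rewrite (_ : _ - _ = a *: (y - \sum_(p : n.-bseq 'I_n.+1 | odd_partition n [seq val i | i <- p])
     b p *: Xit star [seq val i | i <- p]) +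
     (z - \sum_(p : n.-bseq 'I_n.+1 | odd_partition n [seq val i | i <- p])
     d p *: Xit star [seq val i | i <- p])); first exact: Il.
  under eq_bigr => p _ do rewrite scalerDl -scalerA.
  by rewrite big_split -scaler_sumr /= opprD scalerBr addrACA.
move/(PnP char0 Hstar); apply: (lspan_min sS) => _ [q oq ->].
have /andP[pos_q /eqP sum_q] := odd_composition_comp oq.
have qsort : perm_eq q (sort geq q) by rewrite perm_sym perm_sort.
have sz : (size [seq (inord i : 'I_n.+1) | i <- sort geq q] <= n)%N.
  by rewrite size_map size_sort -sum_q leq_size_sumn.
have pE : [seq val i | i <- Bseq sz] = sort geq q.
  rewrite /= -map_comp map_id_in // => i; rewrite mem_sort => iq /=.
  by rewrite inordK // ltnS -sum_q leq_mem_sumn.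
have op : odd_composition n (sort geq q).
  have /andP[odd_q _] := oq; rewrite /odd_composition -(perm_sumn qsort) sum_q eqxx.
  by rewrite andbT /oddword -(perm_all _ qsort).
exists (fun p => (p == Bseq sz)%:R); rewrite (bigD1 (Bseq sz)) /=; last first.
  by rewrite /odd_partition pE op sort_sorted // => a b; apply: leq_total.
rewrite eqxx scale1r big1 ?addr0 => [|p /andP[_ /negPf->]]; last by rewrite scale0r.
by apply: lspan_gen; exists q, (sort geq q); split; rewrite ?pE.
Qed.

Lemma partition_uniq n (p r : n.-bseq 'I_n.+1) :
  odd_partition n [seq val i | i <- p] -> odd_partition n [seq val i | i <- r] ->
  perm_eq [seq val i | i <- p] [seq val i | i <- r] -> p = r.
Proof.
have geq_tr : transitive geq by move=> a b d /= ba db; apply: leq_trans db ba.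
have geq_anti : antisymmetric geq by move=> a b /= ?; apply/anti_leq; rewrite andbC.
move=> /andP[sp _] /andP[sr _] pr; apply: val_inj; apply: (inj_map val_inj).
exact: (sorted_eq geq_tr geq_anti sp sr pr).
Qed.

Lemma long_coef0 n k (x : KS K) g : (size (ctype g) < k)%N -> long n k x -> x@_g = 0.
Proof.
move=> lt_k; have s0 : subspace (fun y : KS K => y@_g = 0).
  by split=> [|a y z yg zg]; rewrite ?mcoeff0 // mcoeffD mcoeffZ yg zg mulr0 addr0.
apply: (lspan_min s0) => _ [q [_ kq ->]]; rewrite /ch mcoeffZ char_coef.
rewrite (_ : perm_eq _ _ = false) ?mulr0 //; apply: contraTF lt_k => /perm_size ->.
by rewrite -leqNgt.
Qed.

(** Induction on the number of parts, evaluating at a permutation of cycle type [p]. Shorter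
    partitions have coefficient 0 by induction; for the others only the leading term can reach this
    cycle type, and only when the partition is [p]. *)
Lemma Xit_partition_free n (b : n.-bseq 'I_n.+1 -> K) :
  \sum_(p : n.-bseq 'I_n.+1 | odd_partition n [seq val i | i <- p])
     b p *: c (Xit star [seq val i | i <- p]) = 0 ->
  forall p : n.-bseq 'I_n.+1, odd_partition n [seq val i | i <- p] -> b p = 0.
Proof.
move=> sum0 p; have [k] := ubnP (size p); elim: k p => // k IHk p le_k odd_p.
have /andP[_ oc_p] := odd_p; have /andP[pos_p _] := odd_composition_comp oc_p.
have [s s_p] := exists_cycle_type pos_p; pose g := gp s : gperm.
have szg : size (ctype g) = size p by rewrite (perm_size s_p) size_map.
have := congr1 (mcoeff g) sum0; rewrite mcoeff0 raddf_sum /= (bigD1 p) //=.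
rewrite big1 ?addr0 => [|r /andP[odd_r np]]; last first.
  rewrite mcoeffZ; have [lt_r|le_r] := ltnP (size r) (size p).
    by rewrite IHk ?mul0r // (leq_trans lt_r).
  have /andP[_ oc_r] := odd_r.
  rewrite -(subrK (lead [seq val i | i <- r] *: ch K [seq val i | i <- r]) (c _)).
  rewrite mcoeffD (long_coef0 _ (c_Xit_lead oc_r)) ?add0r; last by rewrite size_map szg ltnS.
  rewrite mcoeffZ /ch mcoeffZ char_coef (_ : perm_eq _ _ = false) ?mulr0 //.
  apply: contraNF np => gr; apply/eqP/esym/partition_uniq => //.
  by rewrite -(permPr gr) perm_sym.
rewrite mcoeffZ -(subrK (lead [seq val i | i <- p] *: ch K [seq val i | i <- p]) (c _)).
rewrite mcoeffD (long_coef0 _ (c_Xit_lead oc_p)) ?add0r; last by rewrite size_map szg.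
rewrite mcoeffZ /ch mcoeffZ char_coef [ctype g]/(cycle_type s) s_p mulr1.
move/eqP; rewrite !mulf_eq0 (negPf (lead_neq0 pos_p)) (negPf (qfact_neq0 char0 pos_p)).
by rewrite !orbF => /eqP.
Qed.

Lemma ker_rearrangements n (x : KS K) :
  Pn n x -> c x = 0 -> lspan (rearrangements n) x.
Proof.
move=> Px cx0; have [b Ib] := Pn_mod_rearrangements Px.
have DX q : Dall (Xit star q) := Dall_Xit Hstar q.
have DZ a q : Dall (a *: Xit star q) := subspaceZ a sD (DX q).
have Ds : Dall (\sum_(p : n.-bseq 'I_n.+1 | odd_partition n [seq val i | i <- p])
    b p *: Xit star [seq val i | i <- p]) by apply: subspace_sum => // p _; apply: DZ.
have Dx : Dall x.
  apply: (Pall_Dall char0 Hstar); apply: (dsum_gen (n := n)) => //; exact: Pn_subspace.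
have [_] := rearrangements_ker Ib.
rewrite (linear_onB c_lin Dx Ds) cx0 sub0r => /eqP; rewrite oppr_eq0 => /eqP.
rewrite (linear_on_sum sD c_lin) => [|p _]; last exact: DZ.
under eq_bigr => p _ do rewrite (linear_onZ sD c_lin _ (DX _)).
move/Xit_partition_free => b0.
by move: Ib; rewrite big1 ?subr0 // => p /b0->; rewrite scale0r.
Qed.

Lemma W_inner n (f h : bitseq -> K) :
  exists phi, inner_perm (W n f) (W n h) = W n phi.
Proof.
have bil := @inner_perm_bilinear K (fun=> True).
apply: (bilinear_on_lspan (@subspaceT K) bil (@W_subspace K n) _ _ _
  (W_Xi_span n f) (W_Xi_span n h)) => //.
move=> _ _ [q comp_q ->] [r comp_r ->].
by exists (B (size r) q (fun a => (a == r)%:R)); apply: Xi_inner_Xi.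
Qed.

(* The peak space of degree [n] is the left ideal of the descent algebra
   generated by [Xit1 n]. *)
Lemma W_inner_Xit1 n (f : bitseq -> K) : Pn n (inner_perm (W n f) (Xit1 K n)).
Proof.
have [_ linl] := @inner_perm_bilinear K (fun=> True).
apply: (linear_on_image_lspan (f := (@inner_perm K)^~ (Xit1 K n)) (@subspaceT K) (linl _ I)
  (@Pn_subspace K n) _ (W_Xi_span n f)) => _ [q comp_q ->]; split=> //.
by rewrite (Xi_inner_Xit1 Hstar comp_q); apply: Pn_Xit.
Qed.

Lemma Pall_inner (x y : KS K) : Pall x -> Pall y -> Pall (inner_perm x y).
Proof.
have bil := @inner_perm_bilinear K (@Dall K); have sP := @Pall_subspace K.
move=> /(PallP char0 Hstar) Gx /(PallP char0 Hstar) Gy.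
apply: (bilinear_on_lspan sD bil sP _ _ _ Gx Gy).
- by move=> _ [q _ ->]; apply: Dall_Xit.
- by move=> _ [q _ ->]; apply: Dall_Xit.
have odd_pos (q : seq nat) : oddword q -> posword q by apply: sub_all => -[].
move=> _ _ [q oq ->] [r or ->]; have [e|ne] := eqVneq (sumn q) (sumn r); last first.
  by rewrite !(Xit_W Hstar) inner_perm_fun_elt_neq //; case: sP.
have comp_r : composition (sumn r) r by rewrite /composition odd_pos ?eqxx.
(* Write [Xit r] as [Xi r] times [Xit1] and regroup: [Xit q] times [Xi r] stays in the descent
   algebra ([W_inner]), and multiplying by [Xit1] on the right leads into the peak space. *)
rewrite -(Xi_inner_Xit1 Hstar comp_r) (Xit_W Hstar) e (Xi_comp _ comp_r) Xit1_W.
rewrite inner_perm_fun_eltA -!/(W _ _).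
have [phi ->] := W_inner (sumn r) (theta K q) (fun w => (inclb w r)%:R).
rewrite -Xit1_W; apply: (dsum_gen (n := sumn r)); first exact: Pn_subspace.
exact: W_inner_Xit1.
Qed.

End Triangularity.

Theorem theorem6 (K : fieldType) (char0 : [pchar K] =i pred0)
    (star bullet : KS K -> KS K -> KS K) (c : KS K -> KS K)
    (Hstar : is_outer_D star) (Hbullet : is_outer_C bullet)
    (Hc : is_Solomon star bullet c) :
  [/\ algebra_epi (@Pall K) (@inner_perm K) (@Codd K) (@inner_class K) c,
      algebra_epi (@Pall K) star (@Codd K) bullet c,
      [/\ Pall (Xi K [::]), Codd (ch K [::]) & c (Xi K [::]) = ch K [::]],
      forall (n : nat) (x : KS K),
        Pn n x /\ c x = 0 <->
        lspan (fun y => exists q q' : seq nat,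
                [/\ odd_composition n q, odd_composition n q', perm_eq q q'
                  & y = Xit star q - Xit star q']) x
    & forall n : nat,
        c (Xit1 K n) =
        \sum_(p : n.-bseq 'I_n.+1 | odd_partition n [seq val i | i <- p])
           2 ^+ size p *: char K [seq val i | i <- p]].
Proof.
have PD := Pall_Dall char0 Hstar; have [_ c_lin c_star c0 _] := Hc.
have [P0 Pl] := @Pall_subspace K; have [C0 Cl] := @Codd_subspace K.
have c_linP : linear_on (@Pall K) c by move=> a x y /PD Dx /PD Dy; apply: c_lin.
split.
- split=> //.
  + split; split=> //; first exact: (Pall_inner char0 Hstar).
    exact: Codd_inner.
  + exact: (c_Pall_Codd char0 Hstar Hbullet Hc).
  + by move=> x y /PD Dx /PD Dy; apply: (c_inner char0 Hstar Hbullet Hc).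
  + exact: (Codd_onto char0 Hstar Hbullet Hc).
- split=> //.
  + split; split=> //; first exact: (Pall_star char0 Hstar).
    exact: (Codd_bullet char0 Hbullet).
  + exact: (c_Pall_Codd char0 Hstar Hbullet Hc).
  + by move=> x y /PD Dx /PD Dy; apply: c_star.
  + exact: (Codd_onto char0 Hstar Hbullet Hc).
- split.
  + apply/(PallP char0 Hstar)/lspan_gen; by exists [::].
  + apply: (@subspaceZ K _ _ _ (@Codd_subspace K)); apply: lspan_gen; by exists [::].
  + rewrite c0 triv_char_T /ch /qfact big_geq // scale1r char_T.
    apply: T_ext => -[|y p] // /andP[y_gt0 _] /= /eqP.
    by rewrite addn_eq0 (gtn_eqF y_gt0).
- move=> n x; split; first by case; apply: (ker_rearrangements char0 Hstar Hbullet Hc).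
  exact: (rearrangements_ker char0 Hstar Hbullet Hc).
- move=> n; rewrite (c_Xit1 char0 Hstar Hbullet Hc) (T_char_sum n (@theta_class_perm K)).
  (* The left sum runs over all partitions of [n], the right one over odd partitions; [theta_class]
     vanishes on the difference. *)
  rewrite big_mkcond [RHS]big_mkcond; apply: eq_bigr => p _.
  rewrite theta_classE /odd_partition size_map /odd_composition /composition.
  case: sorted => //=; case: (boolP (oddword _)) => [odd_p|_] /=.
    rewrite mul1r (_ : posword _) //; by apply: sub_all odd_p => -[].
  by rewrite mul0r scale0r if_same.
Qed.
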